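(* Let $0 < \alpha < n$, $1 < p < \frac{n}{\alpha}$, let $q$ be such that $\frac{1}{p} - \frac{1}{q} = \frac{\alpha}{n}$, and let $w$ be a weight on $\mathbb{R}^n$. Then the following are equivalent: (i) there is a constant $C<\infty$, independent of $f$, such that $$\|wM_\alpha f\|_{L^{q,\infty}} \le C\, \|f\|_{L^p(w^p)}\qquad\text{for each } f \in L^p(w^p);$$ (ii) $w \in A_{p,q}^*$.
   Context: A weight is a measurable function on $\mathbb{R}^n$ that is non-negative a.e. Cubes are cubes in $\mathbb{R}^n$ with sides parallel to the coordinate axes; $|E|$ is Lebesgue measure. $L^p(w^p)$ consists of the measurable $f$ with $\|f\|_{L^p(w^p)} := \left(\int_{\mathbb{R}^n}|f|^p w^p\,dx\right)^{1/p}<\infty$. Fractional maximal operator: $M_\alpha f(x) := \sup_Q |Q|^{\frac{\alpha}{n}}\frac{1}{|Q|}\int_Q |f(y)|\,dy\cdot \chi_Q(x)$, the supremum over all cubes $Q$ (values in $[0,\infty]$; $M_\alpha f=\infty$ is allowed). Weak $L^r$ quasi-norm, $1\le r<\infty$: $\|f\|_{L^{r,\infty}} := \sup_{\lambda>0}\lambda\,|\{x\in\mathbb{R}^n : |f(x)|>\lambda\}|^{1/r}$. Let $p'=p/(p-1)$. $w\in A_{p,q}^*$ means $$[w]_{A_{p,q}^*} := \sup_{Q}\left(\frac{1}{|Q|}\|w^q \chi_Q\|_{L^{1,\infty}}\right)^{\frac{1}{q}}\left(\frac{1}{|Q|}\int_Q w^{-p'}\,dx\right)^{\frac{1}{p'}}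 < \infty,$$ the supremum over all cubes $Q$. Here $w^{-p'}=\infty$ where $w=0$, and the convention $0\cdot\infty=0$ is used throughout. *)

(* Defs.v *)
From HB Require Import structures.
From mathcomp Require Import all_boot all_order all_algebra.
From mathcomp Require Import all_classical all_reals all_analysis.

Set Implicit Arguments.
Unset Strict Implicit.
Unset Printing Implicit Defensive.

Import Order.TTheory GRing.Theory Num.Theory.
Import numFieldNormedType.Exports.

Local Open Scope classical_set_scope.
Local Open Scope ring_scope.
Local Open Scope ereal_scope.

Section cons_measure.
Context (R : realType) (n : nat).

Definition cons_tuple_pair (x : measurableTypeR R * n.-tuple (measurableTypeR R))
  : n.+1.-tuple (measurableTypeR R) := [tuple of x.1 :: x.2].

Lemma measurable_cons_tuple_pair : measurable_fun setT cons_tuple_pair.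
Proof. exact: measurable_cons. Qed.

Variable mu : {sigma_finite_measure set (n.-tuple (measurableTypeR R)) -> \bar R}.

(* lebesgue_measure \x mu, transported along R * R^n ~ R^n.+1. *)
Definition cons_measure (A : set (n.+1.-tuple (measurableTypeR R))) : \bar R :=
  (@lebesgue_measure R \x mu) (cons_tuple_pair @^-1` A).

Let cons_measure0 : cons_measure set0 = 0.
Proof. by rewrite /cons_measure preimage_set0 measure0. Qed.

Let cons_measure_ge0 A : 0 <= cons_measure A.
Proof. exact: measure_ge0. Qed.

Let measurable_cons_preimage (A : set (n.+1.-tuple (measurableTypeR R))) :
  measurable A -> measurable (cons_tuple_pair @^-1` A).
Proof.
by move=> mA; rewrite -[X in measurable X]setTI; exact: measurable_cons_tuple_pair.
Qed.

Let cons_measure_sigma_additive : semi_sigma_additive cons_measure.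
Proof.
move=> F mF tF mUF; rewrite /cons_measure preimage_bigcup.
apply: measure_semi_sigma_additive.
- by move=> i; exact: measurable_cons_preimage.
- apply/trivIsetP => /= i j _ _ ij; rewrite -preimage_setI.
  by move/trivIsetP : tF => /(_ _ _ _ _ ij) ->//; rewrite preimage_set0.
- by rewrite -preimage_bigcup; exact: measurable_cons_preimage.
Qed.

HB.instance Definition _ := isMeasure.Build _ _ _ cons_measure
  cons_measure0 cons_measure_ge0 cons_measure_sigma_additive.

Let cons_measure_sigma_finite : sigma_finite setT cons_measure.
Proof.
have /sigma_finiteP[F [TF ndF Foo]] := sigma_finiteT (@lebesgue_measure R).
have /sigma_finiteP[G [TG ndG Goo]] := sigma_finiteT mu.
pose g (x : n.+1.-tuple (measurableTypeR R)) :
  measurableTypeR R * n.-tuple (measurableTypeR R) :=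
  (thead x, [tuple of behead x]).
have mg : measurable_fun setT g.
  apply/measurable_fun_pairP; split.
    exact: (measurable_tnth ord0).
  exact: measurable_behead.
have gK : cancel cons_tuple_pair g.
  by move=> [a t]; congr pair; exact/val_inj.
exists (fun k => g @^-1` (F k `*` G k)).
  apply/esym/seteqP; split=> // x _.
  have [i _ Fi] : (\bigcup_i F i) (g x).1 by rewrite -TF.
  have [j _ Gj] : (\bigcup_j G j) (g x).2 by rewrite -TG.
  exists (maxn i j) => //; split=> /=.
    by apply: subsetPset Fi; apply: ndF; exact: leq_maxl.
  by apply: subsetPset Gj; apply: ndG; exact: leq_maxr.
move=> k; have [mF Fkoo] := Foo k; have [mG Gkoo] := Goo k; split.
  by rewrite -[X in measurable X]setTI; apply: mg => //; exact: measurableX.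
rewrite /cons_measure -comp_preimage (_ : g \o _ = id); last exact/funext.
by rewrite preimage_id product_measure1E// lte_mul_pinfty// ge0_fin_numE.
Qed.

HB.instance Definition _ := @Measure_isSigmaFinite.Build _ _ _
  cons_measure cons_measure_sigma_finite.

End cons_measure.

(* n-fold product of the one-dimensional Lebesgue measure, on Borel sets. *)
Fixpoint borel_lebesgue (R : realType) (n : nat) :
    {sigma_finite_measure set (n.-tuple (measurableTypeR R)) -> \bar R} :=
  match n with
  | 0%N => \d_([tuple] : 0.-tuple (measurableTypeR R))
  | m.+1 => cons_measure (borel_lebesgue R m)
  end.

(* R^n with the Lebesgue measurable sets: the Caratheodory sigma-algebra of the
   outer measure of borel_lebesgue, i.e. the completion of the Borel sets. *)
Definition Rn (R : realType) (n : nat) : measurableType _ :=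
  caratheodory_type (mu_ext (borel_lebesgue R n)).

Definition lebesgue_Rn (R : realType) (n : nat) : set (Rn R n) -> \bar R :=
  @completed_measure_extension _ (n.-tuple (measurableTypeR R)) R
    (borel_lebesgue R n).

HB.instance Definition _ (R : realType) (n : nat) :=
  Measure.on (@lebesgue_Rn R n).

Lemma lebesgue_Rn_sigma_finite (R : realType) (n : nat) :
  sigma_finite setT (@lebesgue_Rn R n).
Proof.
exact/completed_measure_extension_sigma_finite/sigma_finiteT.
Qed.

HB.instance Definition _ (R : realType) (n : nat) :=
  @Measure_isSigmaFinite.Build _ _ _ (@lebesgue_Rn R n)
    (@lebesgue_Rn_sigma_finite R n).

Section weights.
Context (R : realType) (n : nat).
Local Notation mu := (@lebesgue_Rn R n).
Implicit Types (w f : Rn R n -> R) (g : Rn R n -> \bar R) (p q r alpha : R).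

(* Closed; as faces are null sets, the suprema below do not depend on this. *)
Definition cube (a : n.-tuple R) (l : R) : set (Rn R n) :=
  [set x : n.-tuple R |
    forall i, (tnth a i <= tnth x i <= tnth a i + l)%R].

Definition cubes : set (set (Rn R n)) :=
  [set Q | exists a l, (0 < l)%R /\ Q = cube a l].

Definition weight w :=
  measurable_fun setT w /\ {ae mu, forall x, (0 <= w x)%R}.

Definition weighted_Lnorm p w f : \bar R :=
  (\int[mu]_x ((`|f x| `^ p * w x `^ p)%R)%:E) `^ p^-1.

Definition weighted_Lp p w : set (Rn R n -> R) :=
  [set f | measurable_fun setT f /\ weighted_Lnorm p w f < +oo].

Definition fractional_maximal alpha f (x : Rn R n) : \bar R :=
  ereal_sup [set mu Q `^ (alpha / n%:R) *
                 ((mu Q)^-1 * \int[mu]_(y in Q) `|f y|%:E) * (\1_Q x)%:E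
            | Q in cubes].

Definition weak_Lnorm r g : \bar R :=
  ereal_sup [set lambda%:E * mu [set x | lambda%:E < `|g x|] `^ r^-1
            | lambda in [set lambda : R | (0 < lambda)%R]].

Definition conjugate_exponent p : R := (p / (p - 1))%R.

(* Inverting in \bar R after taking the power p' makes the integrand +oo where
   w = 0, whereas the real power satisfies 0 `^ (- p') = 0.  In \bar R,
   0 * +oo = 0. *)
Definition Apq_star_const p q w : \bar R :=
  let p' := conjugate_exponent p in
  ereal_sup [set
    ((mu Q)^-1 * weak_Lnorm 1 (fun x => (w x `^ q * \1_Q x)%R%:E)) `^ q^-1 *
    ((mu Q)^-1 * \int[mu]_(x in Q) ((w x `^ p')%R%:E)^-1) `^ p'^-1
    | Q in cubes].

Definition Apq_star p q w := Apq_star_const p q w < +oo.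

End weights.

(* Main.v *)
(* Write sigma = w^(-p'). The necessity of A_{p,q}^* comes from testing on the
   functions max(w, e)^(-p') 1_Q and letting e decrease to 0.

   For the sufficiency, let w > 0 and let sigma(Q) denote the integral of sigma
   over Q. Choosing the level t with |{x in Q : w > t}| <= |Q|/4, the condition
   A_{p,q}^* gives sigma(E) >= c sigma(Q) whenever E is contained in Q and
   |E| >= 3|Q|/4; hence sigma(P) <= (1 - c) sigma(Q) for nested cells P < Q of a
   4-adic grid. Every cube lies in a comparable cell of one of 2^n such grids,
   so up to constants {w M_alpha f > lambda} is covered by the sets
   {x in Q : w A_Q > lambda}, Q a cell and
   A_Q = |Q|^(alpha/n - 1) \int_Q |f|. By A_{p,q}^* the measure of such a set is
   at most C lambda^(-q) (sigma(Q) v_Q^p)^(q/p), where v_Q is the sigma-average of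
   |f|/sigma over Q. As q > p and sigma decays geometrically, summing over the
   cells below a cell T on which v is at most 2 v_T costs a constant, which
   leaves the principal cells, along which v doubles. There
   sum_T sigma(T) v_T^p = \int |f| sum_T v_T^(p-1) 1_T, and the inner sum is
   dominated by its largest term, so Young's inequality bounds the left-hand
   side by a multiple of \int |f|^p w^p. *)
Require Import Defs.
From HB Require Import structures.
From mathcomp Require Import all_boot all_order all_algebra.
From mathcomp Require Import all_classical all_reals all_analysis.
From mathcomp Require Import measurable_realfun measurable_fun_approximation.
From mathcomp Require Import ring lra.

Set Implicit Arguments.
Unset Strict Implicit.
Unset Printing Implicit Defensive.

Import Order.TTheory GRing.Theory Num.Theory.
Import numFieldNormedType.Exports.

Local Open Scope classical_set_scope.
Local Open Scope ring_scope.
Local Open Scope ereal_scope.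

(** * Families with geometric growth *)

Section families.
Local Open Scope ring_scope.
Context {R : realFieldType} {I : eqType}.
Implicit Types (J : seq I) (v s : I -> R).

Lemma seq_argmax v J : J != [::] ->
  exists2 i, i \in J & forall j, j \in J -> v j <= v i.
Proof.
elim: J => //= a [|b J] IH _.
  by exists a; [exact: mem_head|move=> j; rewrite inE => /eqP ->].
have [//|i iJ vi] := IH.
have [vai|via] := leP (v a) (v i).
  by exists i => [|j]; rewrite inE ?iJ ?orbT// => /orP[/eqP ->//|/vi].
exists a => [|j]; first exact: mem_head.
by rewrite inE => /orP[/eqP ->//|/vi /le_trans]; apply; exact: ltW.
Qed.

(** After removal of the largest value [v i], every remaining value is at most [v i / theta], so
    induction on the size bounds the sum by [M + theta / (theta - 1) * (M / theta)], which equals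
    [theta / (theta - 1) * M]. *)
Lemma lacunary_sum (theta M : R) v J : 1 < theta -> 0 <= M -> uniq J ->
  (forall i, i \in J -> 0 <= v i <= M) ->
  (forall i j, i \in J -> j \in J -> i != j ->
    theta * v i <= v j \/ theta * v j <= v i) ->
  \sum_(i <- J) v i <= theta / (theta - 1) * M.
Proof.
move=> theta1; have theta10 : theta - 1 != 0 by rewrite gt_eqF// subr_gt0.
have theta0 : 0 < theta by lra.
have [k] := ubnP (size J); elim: k => // k IH in J M *.
rewrite ltnS => Jk M0 uJ vM lac.
have [->|J0] := eqVneq J [::].
  by rewrite big_nil mulr_ge0// divr_ge0//; lra.
have [i iJ vi] := seq_argmax v J0.
rewrite (big_rem i)//=.
have sub j : j \in rem i J -> j \in J by move/mem_rem.
have /IH : (size (rem i J) < k)%N.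
  by rewrite size_rem//; case: J J0 Jk {uJ vM lac iJ vi sub} => //= _ J.
move=> /(_ (v i / theta)) H.
have /andP[vi0 viM] := vM i iJ.
rewrite [leRHS](_ : _ = M + theta / (theta - 1) * (M / theta)); last first.
  by field; rewrite theta10 gt_eqF.
apply: lerD => //; apply: (@le_trans _ _ (theta / (theta - 1) * (v i / theta))).
  apply: H => //.
  - by rewrite divr_ge0// ltW.
  - exact: rem_uniq.
  - move=> j; rewrite mem_rem_uniq// inE => /andP[ji jJ].
    have /andP[vj0 vjM] := vM j jJ; rewrite vj0/= ler_pdivlMr//.
    have ij : i != j by rewrite eq_sym.
    have [tij|] := lac i j iJ jJ ij; last by rewrite mulrC.
    (* Here [theta * v i <= v j <= v i] with [theta > 1], which forces both values to be zero. *)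
    have := vi j jJ; have : theta * v i = (theta - 1) * v i + v i by ring.
    have : 0 <= (theta - 1) * v i by rewrite mulr_ge0//; lra.
    move=> ? ? ?.
    have e : (theta - 1) * v i = 0 by lra.
    have vi00 : v i = 0.
      by move/eqP : e; rewrite mulf_eq0 (negbTE theta10)/= => /eqP.
    have -> : v j = 0 by lra.
    by rewrite mul0r.
  - by move=> j l /sub jJ /sub lJ; exact: lac.
rewrite ler_wpM2l//; first by rewrite divr_ge0//; lra.
by rewrite ler_pM2r// invr_gt0.
Qed.

(* The principal members: [v] doubles along nested chains of [P]. *)
Lemma principal_subfamily (sub : rel I) v s J : reflexive sub ->
  (forall i j, i \in J -> j \in J -> i != j -> sub i j -> s i < s j) ->
  (forall i, i \in J -> 0 <= v i) -> uniq J ->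
  exists P, [/\ uniq P, {subset P <= J},
    forall i, i \in J -> exists2 t, t \in P & sub i t /\ v i <= 2 * v t &
    forall t t', t \in P -> t' \in P -> t != t' -> sub t t' ->
      2 * v t' <= v t].
Proof.
move=> subxx; have [k] := ubnP (size J); elim: k => // k IH in J *.
rewrite ltnS => Jk incr v0 uJ.
have [->|J0] := eqVneq J [::]; first by exists [::].
(* [i] minimizes [s], and [s] increases strictly along [sub], so no other member lies below [i].
   Adding [i] to the family built from the rest only creates chains in which [i] is the smallest
   member. *)
have [i iJ si] := seq_argmax (fun i => - s i) J0.
have sJ j : j \in rem i J -> j \in J by move/mem_rem.
have /IH : (size (rem i J) < k)%N.
  by rewrite size_rem//; case: J J0 Jk {uJ incr v0 iJ si sJ} => //= _ J.
case.
- by move=> a b /sJ aJ /sJ bJ; exact: incr.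
- by move=> a /sJ /v0.
- exact: rem_uniq.
move=> P [uP PJ cP dP].
have [[t [tP it vit]]|noP] :=
    pselect (exists t, [/\ t \in P, sub i t & v i <= 2 * v t]).
  exists P; split => //; first by move=> j /PJ /sJ.
  move=> j jJ; have [->|ji] := eqVneq j i; first by exists t.
  by apply: cP; rewrite mem_rem_uniq// inE ji.
exists (i :: P); split => /=.
- rewrite uP andbT; apply/negP => /PJ; rewrite mem_rem_uniq// inE.
  by rewrite eqxx.
- by move=> j; rewrite inE => /orP[/eqP -> //|/PJ /sJ].
- move=> j jJ; have [->|ji] := eqVneq j i.
    by exists i; rewrite ?mem_head; split=> //; have := v0 i iJ; lra.
  have [|t tP ?] := cP j; first by rewrite mem_rem_uniq// inE ji.
  by exists t => //; rewrite inE tP orbT.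
- move=> t t'; rewrite !inE => /predU1P[->|tP] /predU1P[->|t'P].
  + by rewrite eqxx.
  + move=> _ it'; rewrite leNgt; apply/negP => vv; apply: noP.
    by exists t'; split=> //; exact: ltW.
  + move=> ti ti'; have tJ := sJ _ (PJ _ tP).
    have := incr _ _ tJ iJ ti ti'; have := si t tJ; lra.
  + exact: dP.
Qed.

End families.

(** * Real powers and a weighted Young inequality *)

Section powers.
Local Open Scope ring_scope.
Context {R : realType}.

Lemma ler_powR_base (x y r : R) : 0 <= r -> 0 <= x -> x <= y ->
  x `^ r <= y `^ r.
Proof.
by move=> r0 x0 xy; apply: ge0_ler_powR => //; rewrite nnegrE ?(le_trans x0 xy).
Qed.

(** Each power splits as [x * x ^ (r - 1)], and the base of the second factor may be enlarged to
    [x + y]. *)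
Lemma powRD_le (x y r : R) : 1 <= r -> 0 <= x -> 0 <= y ->
  x `^ r + y `^ r <= (x + y) `^ r.
Proof.
move=> r1 x0 y0; have r0 : 0 < r by lra.
rewrite -(mulr_powRB1 x0 r0) -(mulr_powRB1 y0 r0) -(mulr_powRB1 (addr_ge0 x0 y0) r0).
rewrite mulrDl; apply: lerD; rewrite ler_wpM2l//.
  by apply: ler_powR_base; rewrite ?subr_ge0// lerDl.
by apply: ler_powR_base; rewrite ?subr_ge0// lerDr.
Qed.

Lemma sum_powR_le (I : Type) (J : seq I) (y : I -> R) (r : R) : 1 <= r ->
  (forall i, 0 <= y i) ->
  \sum_(i <- J) (y i) `^ r <= (\sum_(i <- J) y i) `^ r.
Proof.
move=> r1 y0; elim: J => [|i J IH]; first by rewrite !big_nil powR_ge0.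
rewrite !big_cons; apply: le_trans (powRD_le r1 _ _) => //.
  by rewrite lerD2l.
by rewrite sumr_ge0.
Qed.

(** If [2 C f <= m sg], the product is at most the first term. Otherwise [m < 2 C f / sg], and
    inserting this bound for [m] gives the second term. The factor 1/2 allows the first term to be
    absorbed after integration. *)
Lemma young_weighted (p C f m sg : R) : 1 < p -> 0 < C -> 0 <= f -> 0 <= m ->
  0 < sg -> f * (C * m `^ (p - 1)) <=
    2^-1 * (m `^ p * sg) + (2 * C) `^ p * (f `^ p * sg `^ (1 - p)).
Proof.
move=> p1 C0 f0 m0 sg0; have p0 : 0 < p by lra.
have p10 : 0 <= p - 1 by lra.
have [fm|mf] := leP (2 * C * f) (m * sg).
  apply: ler_wpDr; first by rewrite !mulr_ge0// powR_ge0.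
  rewrite -(mulr_powRB1 m0 p0).
  have -> : f * (C * m `^ (p - 1)) = 2^-1 * (2 * C * f * m `^ (p - 1)) by field.
  rewrite ler_pM2l ?invr_gt0//.
  rewrite [leRHS](_ : _ = m * sg * m `^ (p - 1)); last by ring.
  by rewrite ler_wpM2r// powR_ge0.
apply: ler_wpDl; first by rewrite !mulr_ge0// ?powR_ge0// ltW.
have CfC : 0 <= 2 * C * f by rewrite !mulr_ge0// ltW.
have -> : (2 * C) `^ p * (f `^ p * sg `^ (1 - p)) =
    2 * C * f * ((2 * C * f) `^ (p - 1) * sg `^ (1 - p)).
  rewrite mulrA -powRM//; last by rewrite mulr_ge0// ltW.
  by rewrite -(mulr_powRB1 CfC p0) mulrA.
have -> : sg `^ (1 - p) = (sg `^ (p - 1))^-1 by rewrite -powRN opprB.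
have sgp : 0 < sg `^ (p - 1) by rewrite powR_gt0.
have : m `^ (p - 1) <= (2 * C * f) `^ (p - 1) / sg `^ (p - 1).
  rewrite ler_pdivlMr// -powRM ?(ltW sg0)//.
  by apply: ler_powR_base; rewrite ?mulr_ge0// ltW.
set u := m `^ _; set z := (_ / _) => uz.
have u0 : 0 <= u by exact: powR_ge0.
rewrite (_ : f * (C * u) = C * f * u); last by ring.
apply: ler_pM => //; first by rewrite mulr_ge0// ltW.
by rewrite -mulrA ler_peMl ?mulr_ge0 ?(ltW C0)// ler1n.
Qed.

End powers.

(** * Measurability of the functions to be integrated *)

Section measurability.
Context d (T : measurableType d) (R : realType).
Implicit Types (h k : T -> R) (E : set T).

Lemma measurable_fun_powR h (r : R) : measurable_fun setT h ->
  measurable_fun setT (fun x => h x `^ r)%R.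
Proof. by move=> mh; apply: (measurableT_comp (f := fun y : R => (y `^ r)%R)). Qed.

Lemma measurable_fun_max_powR h (e r : R) : measurable_fun setT h ->
  measurable_fun setT (fun x => Num.max (h x) e `^ r)%R.
Proof. by move=> mh; apply: measurable_fun_powR; exact: measurable_maxr. Qed.

Lemma measurable_fun_norm h : measurable_fun setT h ->
  measurable_fun setT (fun x => `|h x|)%R.
Proof. by move=> mh; exact: measurableT_comp. Qed.

Lemma measurable_fun_norm_powRM h k (r : R) : measurable_fun setT h ->
  measurable_fun setT k ->
  measurable_fun setT (fun x => `|h x| `^ r * k x `^ r)%R.
Proof.
move=> mh mk; apply: measurable_funM; first exact/measurable_fun_powR/measurable_fun_norm.
exact: measurable_fun_powR.
Qed.

Lemma measurable_EFin_restrict E h : measurable_fun setT h ->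
  measurable_fun E (fun x => (h x)%:E).
Proof. by move=> mh; apply/measurable_EFinP; exact: measurable_funS mh. Qed.

Lemma measurable_fun_indicM E h : measurable E -> measurable_fun setT h ->
  measurable_fun setT (fun x => h x * \1_E x)%R.
Proof. by move=> mE mh; exact: measurable_funM. Qed.

Lemma measurable_inv_powR h (r : R) :
  measurable_fun setT h -> measurable_fun setT (fun x => ((h x `^ r)%:E)^-1).
Proof.
move=> mh; rewrite (_ : (fun _ => _) =
    (fun x => if (h x `^ r == 0)%R then +oo else (h x `^ (- r))%:E)).
  apply: measurable_fun_ifT => //.
    by apply: measurable_fun_eqr => //; exact: measurable_fun_powR.
  by apply/measurable_EFinP; exact: measurable_fun_powR.
by apply/funext => x; rewrite inver powRN.
Qed.

End measurability.

(** * Integrals against weighted overlaps of finite families *)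

Section weighted_sums.
Context d (T : measurableType d) (R : realType) (mu : {measure set T -> \bar R}).
Context (I : eqType).
Implicit Types (J : seq I) (c : I -> R) (Q : I -> set T) (h : T -> R).

Definition overlap J c Q x : R := (\sum_(i <- J | x \in Q i) c i)%R.

Lemma overlap_ge0 J c Q x : (forall i, 0 <= c i)%R -> (0 <= overlap J c Q x)%R.
Proof. by move=> c0; apply: sumr_ge0. Qed.

Lemma overlapE J c Q h x : (h x * overlap J c Q x)%:E =
  \sum_(i <- J) (c i)%:E * (h x * \1_(Q i) x)%:E.
Proof.
under eq_bigr do rewrite -EFinM.
rewrite sumEFin mulr_sumr [in LHS]big_mkcond/=; congr EFin.
apply: eq_bigr => i _; rewrite indicE.
by case: ifPn => _; rewrite ?mulr1 ?mulr0 // mulrC.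
Qed.

Lemma measurable_mul_indic Q h i : (forall i, measurable (Q i)) ->
  measurable_fun setT h -> measurable_fun setT (fun x => (h x * \1_(Q i) x)%:E).
Proof.
by move=> mQ mh; apply/measurable_EFinP; exact: measurable_funM.
Qed.

Lemma measurable_overlap J c Q h : (forall i, measurable (Q i)) ->
  measurable_fun setT h ->
  measurable_fun setT (fun x => (h x * overlap J c Q x)%:E).
Proof.
move=> mQ mh; under eq_fun do rewrite overlapE.
apply: emeasurable_sum => i; apply: measurable_funeM.
exact: measurable_mul_indic.
Qed.

Lemma integral_overlap J c Q h : (forall i, 0 <= c i)%R ->
  (forall i, measurable (Q i)) -> measurable_fun setT h ->
  (forall x, 0 <= h x)%R ->
  \int[mu]_x (h x * overlap J c Q x)%:E =
  \sum_(i <- J) (c i)%:E * \int[mu]_(x in Q i) (h x)%:E.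
Proof.
move=> c0 mQ mh h0; under eq_integral do rewrite overlapE.
have hQ0 i x : 0 <= (h x * \1_(Q i) x)%:E.
  by rewrite lee_fin mulr_ge0// indicE.
have mhQ i : measurable_fun setT (fun x => (h x * \1_(Q i) x)%:E).
  exact: measurable_mul_indic.
rewrite ge0_integral_sum//; last 2 first.
- by move=> i; apply: measurable_funeM.
- by move=> i x _; rewrite mule_ge0// lee_fin.
apply: eq_bigr => i _; rewrite ge0_integralZl_EFin//.
by rewrite [in RHS]integral_mkcond epatch_indic; congr (_ * _).
Qed.

End weighted_sums.

(** * Laminar families of sets *)

Section laminar_families.
Context d (T : measurableType d) (R : realType) (mu : {measure set T -> \bar R}).
Context (I : eqType).
Implicit Types (J : seq I) (Q : I -> set T) (s : I -> R) (sg : T -> R).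

Definition laminar J Q := forall i j, i \in J -> j \in J ->
  [\/ Q i `<=` Q j, Q j `<=` Q i | Q i `&` Q j = set0].

Lemma laminarP J Q i j x : laminar J Q -> i \in J -> j \in J ->
  x \in Q i -> x \in Q j -> Q i `<=` Q j \/ Q j `<=` Q i.
Proof.
move=> lam iJ jJ /set_mem xi /set_mem xj.
case: (lam i j iJ jJ) => [|| /seteqP[/(_ x (conj xi xj))]//].
  by left.
by right.
Qed.

(** Since [s i] is the integral of [sg] over [Q i], the sum of [s i ^ r] is the integral of [sg]
    times the overlap with coefficients [s i ^ (r - 1)]. The members through a point form a chain
    along which [s] decays by [rho], so this overlap is a geometric sum dominated by its top term
    [s t ^ (r - 1)]. *)
Lemma laminar_packing (rho r : R) J Q s sg t :
  (0 < rho < 1)%R -> (1 < r)%R -> uniq J -> laminar J Q ->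
  (forall i, measurable (Q i)) -> (forall i, 0 < s i)%R ->
  (forall i j, i \in J -> j \in J -> i != j -> Q i `<=` Q j ->
    (s i <= rho * s j)%R) ->
  measurable_fun setT sg -> (forall x, 0 <= sg x)%R ->
  (forall i, \int[mu]_(x in Q i) (sg x)%:E = (s i)%:E) ->
  t \in J ->
  (\sum_(i <- J | `[< Q i `<=` Q t >]) s i `^ r <=
    (1 - rho `^ (r - 1))^-1 * s t `^ r)%R.
Proof.
move=> /andP[rho0 rho1] r1 uJ lam mQ s0 dec msg sg0 sE tJ.
have r0 : (0 < r)%R by lra.
have r10 : (0 < r - 1)%R by lra.
have rhor0 : (0 < rho `^ (r - 1))%R by rewrite powR_gt0.
have rhor1 : (rho `^ (r - 1) < 1)%R.
  have : (rho `^ (r - 1) < 1 `^ (r - 1))%R.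
    by apply: gt0_ltr_powR => //; rewrite nnegrE// ltW.
  by rewrite powR1.
have sle i : i \in J -> Q i `<=` Q t -> (s i <= s t)%R.
  move=> iJ it; have [->//|ij] := eqVneq i t.
  by rewrite (le_trans (dec _ _ iJ tJ ij it))// ler_piMl ?ltW.
set A := ((1 - rho `^ (r - 1))^-1)%R.
have A0 : (0 <= A)%R by rewrite invr_ge0 subr_ge0 ltW.
rewrite -big_filter; set J' := [seq i <- J | _].
have J'J i : i \in J' -> i \in J /\ Q i `<=` Q t.
  by rewrite mem_filter => /andP[/asboolP].
have st10 : (0 <= A * s t `^ (r - 1))%R by rewrite mulr_ge0// powR_ge0.
have pw x : (sg x * overlap J' (fun i => s i `^ (r - 1)) Q x <=
    A * s t `^ (r - 1) * (sg x * \1_(Q t) x))%R.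
  rewrite [leRHS]mulrCA ler_wpM2l//.
  have [xt|xt] := boolP (x \in Q t); last first.
    rewrite indicE (negbTE xt) mulr0 /overlap big_seq_cond big1// => i.
    move=> /andP[/J'J[_ it] /set_mem xi]; have := it _ xi.
    by move/mem_set; rewrite (negbTE xt).
  rewrite indicE xt mulr1 /overlap -big_filter.
  (* The terms at [x] are lacunary with ratio [theta = rho ^ (1 - r)], for which
     [theta / (theta - 1)] is [A]. *)
  have -> : A = ((rho `^ (r - 1))^-1 / ((rho `^ (r - 1))^-1 - 1))%R.
    by rewrite /A; field; rewrite !gt_eqF//; lra.
  apply: (@lacunary_sum R I _ _ (fun i => s i `^ (r - 1))%R).
  - by rewrite invf_gt1.
  - exact: powR_ge0.
  - by rewrite !filter_uniq.
  - move=> i; rewrite mem_filter => /andP[_ /J'J[iJ it]].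
    rewrite powR_ge0/=; apply: ler_powR_base; [exact: ltW|exact: ltW|].
    exact: sle.
  - move=> i j; rewrite mem_filter => /andP[xi /J'J[iJ _]].
    rewrite mem_filter => /andP[xj /J'J[jJ _]] ij.
    have half k l : k \in J -> l \in J -> k != l -> Q k `<=` Q l ->
        ((rho `^ (r - 1))^-1 * s k `^ (r - 1) <= s l `^ (r - 1))%R.
      move=> kJ lJ kl kll; rewrite mulrC ler_pdivrMr// mulrC.
      rewrite -powRM ?(ltW rho0) ?(ltW (s0 _))//.
      by apply: ler_powR_base; [exact: ltW|exact: ltW|exact: dec].
    have [|] := laminarP lam iJ jJ xi xj => H; [left|right]; apply: half => //.
    by rewrite eq_sym.
rewrite -lee_fin.
have -> : (A * s t `^ r)%:E =
    \int[mu]_x (A * s t `^ (r - 1) * (sg x * \1_(Q t) x))%:E.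
  under eq_integral do rewrite EFinM.
  rewrite ge0_integralZl_EFin//; last 2 first.
  - by move=> x _; rewrite lee_fin mulr_ge0// indicE.
  - by apply: measurable_mul_indic.
  under eq_integral do rewrite EFinM.
  rewrite -[X in \int[_]_x X x]epatch_indic -integral_mkcond sE -EFinM.
  by rewrite -mulrA [(s t `^ (r - 1) * _)%R]mulrC mulr_powRB1// ltW.
have -> : (\sum_(i <- J') s i `^ r)%:E =
    \int[mu]_x (sg x * overlap J' (fun i => s i `^ (r - 1)) Q x)%:E.
  rewrite integral_overlap//; last by move=> i; exact: powR_ge0.
  rewrite -sumEFin; apply: eq_bigr => i _; rewrite sE -EFinM mulrC.
  by rewrite mulr_powRB1// ltW.
apply: ge0_le_integral => //.
- move=> x _; rewrite lee_fin mulr_ge0// overlap_ge0// => i; exact: powR_ge0.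
- exact: measurable_overlap.
- under eq_fun do rewrite EFinM.
  by apply: measurable_funeM; exact: measurable_mul_indic.
- by move=> x _; rewrite lee_fin.
Qed.

End laminar_families.

(** * A Carleson-type embedding over laminar families *)

Section embedding.
Context d (T : measurableType d) (R : realType) (mu : {measure set T -> \bar R}).
Context (I : eqType).
Implicit Types (J P : seq I) (Q : I -> set T) (s v : I -> R) (sg f phi : T -> R).

(** The sum [Y] on the left is both the integral of [f] against the overlap of the [v i ^ (p - 1)]
    and that of [sg] against the overlap of the [v i ^ p]. Along the chain through a point [v]
    doubles, so the first overlap is comparable to its largest term. Young's inequality at that term
    then gives [Y <= Y / 2 + const * Phi]. *)
Lemma principal_sum (p : R) P Q s v f sg phi (Phi : R) :
  (1 < p)%R -> uniq P -> laminar P Q ->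
  (forall i, measurable (Q i)) -> (forall i, 0 <= v i)%R ->
  (forall i j, i \in P -> j \in P -> i != j -> Q i `<=` Q j ->
    (2 * v j <= v i)%R) ->
  measurable_fun setT f -> (forall x, 0 <= f x)%R ->
  measurable_fun setT sg -> (forall x, 0 < sg x)%R ->
  measurable_fun setT phi -> (forall x, phi x = f x `^ p * sg x `^ (1 - p))%R ->
  (forall i, \int[mu]_(x in Q i) (sg x)%:E = (s i)%:E) ->
  (forall i, \int[mu]_(x in Q i) (f x)%:E = (v i * s i)%:E) ->
  \int[mu]_x (phi x)%:E = Phi%:E ->
  (\sum_(i <- P) v i `^ p * s i <=
    2 * (2 * (2 `^ (p - 1) / (2 `^ (p - 1) - 1))) `^ p * Phi)%R.
Proof.
move=> p1 uP lam mQ v0 dbl mf f0 msg sg0 mphi phiE sE aE PhiE.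
have p0 : (0 < p)%R by lra.
have p10 : (0 < p - 1)%R by lra.
have th1 : (1 < (2:R) `^ (p - 1))%R.
  have : (1 `^ (p - 1) < (2:R) `^ (p - 1))%R.
    by apply: gt0_ltr_powR => //; rewrite ?nnegrE// ltr1n.
  by rewrite powR1.
set C := (2 `^ (p - 1) / (2 `^ (p - 1) - 1))%R.
have C0 : (0 < C)%R by rewrite divr_gt0//; lra.
have phi0 x : (0 <= phi x)%R by rewrite phiE mulr_ge0 ?powR_ge0.
pose V c x := overlap P (fun i => v i `^ c)%R Q x.
have V0 c x : (0 <= V c x)%R by apply: overlap_ge0 => i; exact: powR_ge0.
set Y := (\sum_(i <- P) v i `^ p * s i)%R.
have YE : Y%:E = \int[mu]_x (f x * V (p - 1) x)%:E.
  rewrite integral_overlap//; last by move=> i; exact: powR_ge0.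
  rewrite -sumEFin; apply: eq_bigr => i _; rewrite aE -EFinM mulrA.
  by rewrite [(v i `^ (p - 1) * _)%R]mulrC mulr_powRB1.
have YE' : Y%:E = \int[mu]_x (sg x * V p x)%:E.
  rewrite integral_overlap//; first last.
  - by move=> x; exact: ltW.
  - by move=> i; exact: powR_ge0.
  by rewrite -sumEFin; apply: eq_bigr => i _; rewrite sE -EFinM.
have pw x : (f x * V (p - 1) x <=
    2^-1 * (sg x * V p x) + (2 * C) `^ p * phi x)%R.
  have Cp0 : (0 <= (2 * C) `^ p)%R by exact: powR_ge0.
  have [E|E] := eqVneq [seq i <- P | x \in Q i] [::].
    rewrite {1}/V /overlap -big_filter E big_nil mulr0.
    by rewrite addr_ge0// !mulr_ge0// ltW.
  have [k] := seq_argmax v E; rewrite mem_filter => /andP[xk kP] vk.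
  have VC : (V (p - 1) x <= C * v k `^ (p - 1))%R.
    rewrite /V /overlap -big_filter.
    apply: (@lacunary_sum R I _ _ (fun i => v i `^ (p - 1))%R) => //.
    - exact: powR_ge0.
    - exact: filter_uniq.
    - move=> i iP; rewrite powR_ge0/=; apply: ler_powR_base => //; first exact: ltW.
      exact: vk.
    - move=> i j; rewrite mem_filter => /andP[xi iP].
      rewrite mem_filter => /andP[xj jP] ij.
      have half l m : l \in P -> m \in P -> l != m -> Q l `<=` Q m ->
          (2 `^ (p - 1) * v m `^ (p - 1) <= v l `^ (p - 1))%R.
        move=> lP mP lm Qlm; rewrite -powRM//; apply: ler_powR_base.
        + exact: ltW.
        + by rewrite mulr_ge0.
        + exact: dbl.
      have [|] := laminarP lam iP jP xi xj => H; [right|left]; apply: half => //.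
      by rewrite eq_sym.
  have vV : (v k `^ p <= V p x)%R.
    rewrite /V /overlap (big_rem k)//= xk lerDl sumr_ge0// => i _.
    exact: powR_ge0.
  apply: le_trans (_ : f x * (C * v k `^ (p - 1)) <= _)%R; first exact: ler_wpM2l.
  apply: le_trans (young_weighted p1 C0 (f0 x) (v0 k) (sg0 x)) _.
  rewrite -phiE lerD2r ler_pM2l ?invr_gt0// mulrC ler_wpM2l//; exact: ltW.
have : Y%:E <= (2^-1 * Y + (2 * C) `^ p * Phi)%:E.
  rewrite EFinD !EFinM {2}YE' -PhiE YE -ge0_integralZl_EFin//; last first.
  - exact: measurable_overlap.
  - by move=> x _; rewrite lee_fin mulr_ge0// ltW.
  rewrite -ge0_integralZl_EFin//; last 3 first.
  - by move=> x _; rewrite lee_fin.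
  - exact/measurable_EFinP.
  - exact: powR_ge0.
  rewrite -ge0_integralD//; first last.
  - by apply: measurable_funeM; exact/measurable_EFinP.
  - by move=> x _; rewrite mule_ge0// lee_fin ?powR_ge0.
  - by apply: measurable_funeM; exact: measurable_overlap.
  - by move=> x _; rewrite mule_ge0// lee_fin// mulr_ge0// ltW.
  apply: ge0_le_integral => //.
  - by move=> x _; rewrite lee_fin mulr_ge0.
  - exact: measurable_overlap.
  - apply: emeasurable_funD; first by apply: measurable_funeM; exact: measurable_overlap.
    by apply: measurable_funeM; exact/measurable_EFinP.
  - by move=> x _; rewrite -!EFinM -EFinD lee_fin.
(* [Y] is a real number, so [Y / 2] can be subtracted; this is the source of the leading factor
   2. *)
rewrite lee_fin => H; rewrite -mulrA; lra.
Qed.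

(** Each member lies in a principal one with at least half its average. Packing sums the members
    below each principal one, and [r > 1] lets the sum of [r]-th powers over the principal members
    be bounded by the [r]-th power of their sum. The constant is chosen before the family, so it
    serves all finite families of cells at once. *)
Lemma laminar_embedding (p r rho : R) :
  (1 < p)%R -> (1 < r)%R -> (0 < rho < 1)%R ->
  exists2 C, (0 <= C)%R & forall J Q s v f sg phi (Phi : R),
  uniq J -> laminar J Q ->
  (forall i, measurable (Q i)) -> (forall i, 0 < s i)%R ->
  (forall i, 0 <= v i)%R ->
  (forall i j, i \in J -> j \in J -> i != j -> Q i `<=` Q j ->
    (s i <= rho * s j)%R) ->
  measurable_fun setT f -> (forall x, 0 <= f x)%R ->
  measurable_fun setT sg -> (forall x, 0 < sg x)%R ->
  measurable_fun setT phi -> (forall x, phi x = f x `^ p * sg x `^ (1 - p))%R ->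
  (forall i, \int[mu]_(x in Q i) (sg x)%:E = (s i)%:E) ->
  (forall i, \int[mu]_(x in Q i) (f x)%:E = (v i * s i)%:E) ->
  \int[mu]_x (phi x)%:E = Phi%:E ->
  (\sum_(i <- J) (v i `^ p * s i) `^ r <= C * Phi `^ r)%R.
Proof.
move=> p1 r1 /andP[rho0 rho1].
set A := ((1 - rho `^ (r - 1))^-1)%R.
set B := (2 * (2 * (2 `^ (p - 1) / (2 `^ (p - 1) - 1))) `^ p)%R.
have r0 : (0 < r)%R by lra.
have B0 : (0 <= B)%R by rewrite mulr_ge0// powR_ge0.
have A0 : (0 <= A)%R.
  have : (rho `^ (r - 1) <= 1 `^ (r - 1))%R by apply: ler_powR_base; lra.
  by rewrite powR1 invr_ge0 subr_ge0.
exists ((2 `^ p) `^ r * A * B `^ r)%R.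
  by rewrite !mulr_ge0// powR_ge0.
move=> J Q s v f sg phi Phi uJ lam mQ s0 v0 dec mf f0 msg sg0 mphi phiE sE aE PhiE.
have s00 i : (0 <= s i)%R by exact: ltW.
have subs i j : i \in J -> j \in J -> i != j -> `[< Q i `<=` Q j >] ->
    (s i < s j)%R.
  by move=> iJ jJ ij /asboolP/(dec _ _ iJ jJ ij)/le_lt_trans; apply; rewrite gtr_pMl.
have [|P [uP PJ cP dP]] := principal_subfamily _ subs (fun i _ => v0 i) uJ.
  by move=> i; exact/asboolP.
have Yle : (\sum_(i <- P) v i `^ p * s i <= B * Phi)%R.
  apply: (@principal_sum p P Q s v f sg phi) => //.
    by move=> i j /PJ iJ /PJ jJ; exact: lam.
  by move=> i j iP jP ij /asboolP; exact: dP.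
pose F t i := ((2 * v t) `^ p * s i)%R.
have F0 t i : (0 <= F t i)%R by rewrite mulr_ge0// powR_ge0.
have step i : i \in J -> ((v i `^ p * s i) `^ r <=
    \sum_(t <- P | `[< Q i `<=` Q t >]) F t i `^ r)%R.
  move=> iJ; have [t tP [it vit]] := cP i iJ.
  rewrite (big_rem t)//= it; apply: ler_wpDr.
    by apply: sumr_ge0 => k _; exact: powR_ge0.
  apply: ler_powR_base; [exact: ltW|by rewrite mulr_ge0// powR_ge0|].
  rewrite ler_wpM2r//; apply: ler_powR_base => //; lra.
apply: (@le_trans _ _ (\sum_(i <- J) \sum_(t <- P | `[< Q i `<=` Q t >]) F t i `^ r)%R).
  by rewrite big_seq [leRHS]big_seq; apply: ler_sum.
(* Grouping by the principal member [t] leaves the sum of [s i ^ r] over the members inside [Q t],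
   which is the packing sum. *)
rewrite (exchange_big_dep xpredT)//=.
apply: (@le_trans _ _ (\sum_(t <- P) (2 `^ p) `^ r * A * (v t `^ p * s t) `^ r)%R).
  rewrite big_seq [leRHS]big_seq; apply: ler_sum => t tP.
  have -> : (\sum_(i <- J | `[< Q i `<=` Q t >]) F t i `^ r =
      (2 `^ p) `^ r * (v t `^ p) `^ r * \sum_(i <- J | `[< Q i `<=` Q t >]) s i `^ r)%R.
    rewrite mulr_sumr; apply: eq_bigr => i _.
    by rewrite /F powRM ?powR_ge0// powRM// powRM ?powR_ge0.
  rewrite [((_ * _) `^ r)%R]powRM ?powR_ge0// [leRHS]mulrACA; apply: ler_wpM2l.
    by rewrite mulr_ge0// powR_ge0.
  apply: (@laminar_packing _ _ _ mu I rho r J Q s sg t) => //.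
  - by rewrite rho0.
  - by move=> x; exact: ltW.
  - exact: PJ.
rewrite -mulr_sumr -!mulrA ler_wpM2l ?powR_ge0// ler_wpM2l//.
apply: le_trans (sum_powR_le _ (ltW r1) _) _.
  by move=> i; rewrite mulr_ge0// powR_ge0.
have Phi0 : (0 <= Phi)%R.
  rewrite -lee_fin -PhiE integral_ge0// => x _.
  by rewrite lee_fin phiE mulr_ge0 ?powR_ge0.
rewrite -powRM//; apply: ler_powR_base; [exact: ltW| |exact: Yle].
by apply: sumr_ge0 => i _; rewrite mulr_ge0// powR_ge0.
Qed.

End embedding.

(** * Cubes and 4-adic grids *)

Section boxes.
Context {R : realType}.

Definition box n (J : 'I_n -> set R) : set (Rn R n) :=
  [set x : n.-tuple R | forall i, J i (tnth x i)].

Lemma borel_measurable_box n (J : 'I_n -> set (measurableTypeR R)) :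
  (forall i, measurable (J i)) ->
  measurable (box J : set (n.-tuple (measurableTypeR R))).
Proof.
move=> mJ; rewrite (_ : box J = \bigcap_(i in [set: 'I_n])
    ((fun x : n.-tuple (measurableTypeR R) => tnth x i) @^-1` J i)).
  apply: fin_bigcap_measurable => // i _; rewrite -[X in measurable X]setTI.
  exact: measurable_tnth.
by apply/seteqP; split=> [x Jx i _|x Jx i]; [exact: Jx|exact: (Jx i I)].
Qed.

(** Induction on the dimension: along the cons map a box is its first side times the box of the
    remaining sides, and in dimension 0 the Dirac mass gives 1. *)
Lemma borel_lebesgue_box (l : R) n (J : 'I_n -> set (measurableTypeR R)) :
  (forall i, measurable (J i)) -> (forall i, lebesgue_measure (J i) = l%:E) ->
  borel_lebesgue R n (box J) = (l ^+ n)%:E.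
Proof.
elim: n J => [|n IH] J mJ lJ /=.
  by rewrite expr0 diracE mem_set// => -[].
rewrite /cons_measure.
rewrite (_ : _ @^-1` _ = J ord0 `*` box (fun i => J (lift ord0 i))).
  rewrite product_measure1E//; last exact: borel_measurable_box.
  rewrite IH// [X in X * _](_ : _ = l%:E) ?EFinM ?exprS//; exact: (lJ ord0).
apply/seteqP; split=> [[x t] /= xt|[x t] /= [xJ tJ]].
  split; first exact: (xt ord0).
  by move=> i; have := xt (lift ord0 i); rewrite tnthS.
move=> i; have [->|[j ->]] : i = ord0 \/ exists j, i = lift ord0 j.
- by case: (unliftP ord0 i) => [j ->|->]; [right; exists j|left].
- exact: xJ.
- by have := tJ j; rewrite /= tnthS.
Qed.

Lemma measurable_box n (J : 'I_n -> set (measurableTypeR R)) :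
  (forall i, measurable (J i)) -> measurable (box J).
Proof.
by move=> mJ; apply: caratheodory_measurable_mu_ext; exact: borel_measurable_box.
Qed.

Lemma lebesgue_Rn_box (l : R) n (J : 'I_n -> set (measurableTypeR R)) :
  (forall i, measurable (J i)) -> (forall i, lebesgue_measure (J i) = l%:E) ->
  lebesgue_Rn (box J) = (l ^+ n)%:E.
Proof.
move=> mJ lJ; rewrite -(borel_lebesgue_box mJ lJ).
by apply: measurable_mu_extE; exact: borel_measurable_box.
Qed.

(** Half-open, so that the translates forming one scale of a grid are disjoint. *)
Definition hcube n (a : n.-tuple R) (l : R) : set (Rn R n) :=
  box (fun i => `[tnth a i, (tnth a i + l)%R[%classic).

Lemma cubeE n (a : n.-tuple R) (l : R) :
  cube a l = box (fun i => `[tnth a i, (tnth a i + l)%R]%classic).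
Proof. by apply/seteqP; split=> x /= + i => /(_ i); rewrite /= in_itv. Qed.

Lemma hcube_sub_cube n (a : n.-tuple R) (l : R) : hcube a l `<=` cube a l.
Proof.
move=> x /= + i => /(_ i); rewrite /= in_itv/= => /andP[-> /ltW ->//].
Qed.

Lemma measurable_cube n (a : n.-tuple R) (l : R) : measurable (cube a l).
Proof. by rewrite cubeE; apply: measurable_box => i; exact: measurable_itv. Qed.

Lemma measurable_hcube n (a : n.-tuple R) (l : R) : measurable (hcube a l).
Proof. by apply: measurable_box => i; exact: measurable_itv. Qed.

Lemma lebesgue_Rn_cube n (a : n.-tuple R) (l : R) : (0 < l)%R ->
  lebesgue_Rn (cube a l) = (l ^+ n)%:E.
Proof.
move=> l0; rewrite cubeE; apply: lebesgue_Rn_box => i; first exact: measurable_itv.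
by rewrite lebesgue_measure_itv/= lte_fin ltrDl l0 -EFinD addrAC subrr add0r.
Qed.

Lemma lebesgue_Rn_hcube n (a : n.-tuple R) (l : R) : (0 < l)%R ->
  lebesgue_Rn (hcube a l) = (l ^+ n)%:E.
Proof.
move=> l0; apply: lebesgue_Rn_box => i; first exact: measurable_itv.
by rewrite lebesgue_measure_itv/= lte_fin ltrDl l0 -EFinD addrAC subrr add0r.
Qed.

(** [lebesgue_Rn] is the outer measure generated by [borel_lebesgue], hence monotone on arbitrary
    sets. Superlevel sets of the maximal function are estimated in this way. *)
Lemma le_lebesgue_Rn n (A B : set (Rn R n)) : A `<=` B ->
  lebesgue_Rn A <= lebesgue_Rn B.
Proof. by move=> AB; apply: (le_mu_ext (borel_lebesgue R n)). Qed.

End boxes.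

(** * Shifted 4-adic grids and the covering of cubes by cells *)

Section grids.
Local Open Scope ring_scope.
Context {R : realType} {n : nat}.
Implicit Types (t : {ffun 'I_n -> bool}) (d e : int * n.-tuple int).

(* Scale [4 ^ d.1]; since [4 = 1 %[mod 3]], a shift by one third of the scale
   keeps the cells nested. *)
Definition corner t d : n.-tuple R :=
  [tuple 4 ^ d.1 * ((tnth d.2 i)%:~R + (t i)%:R / 3) | i < n].

Definition cell t d : set (Rn R n) := hcube (corner t d) (4 ^ d.1).

Lemma cellP t d (x : n.-tuple R) : cell t d x <->
  forall i, 4 ^ d.1 * ((tnth d.2 i)%:~R + (t i)%:R / 3) <= tnth x i
    < 4 ^ d.1 * ((tnth d.2 i)%:~R + (t i)%:R / 3 + 1).
Proof.
by split=> /= H i; have := H i; rewrite /= in_itv/= tnth_mktuple !mulrDr !mulr1.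
Qed.

Lemma exp4_gt0 (k : int) : 0 < (4 : R) ^ k.
Proof. by rewrite exprz_gt0. Qed.

Lemma corner_cell t d : cell t d (corner t d).
Proof.
apply/cellP => i; rewrite tnth_mktuple lexx/= ltr_pM2l ?exp4_gt0//.
by rewrite ltrDl.
Qed.

(** The identity [4 (m + b/3) = (4 m + b) + b/3], iterated [j] times: lattice points of a coarse
    scale are lattice points of each finer scale with the same shift. *)
Lemma refine_grid (b : bool) (k : int) (j : nat) (m : int) : exists M : int,
  (4 : R) ^ (k + j%:Z) * (m%:~R + b%:R / 3) = 4 ^ k * (M%:~R + b%:R / 3).
Proof.
rewrite expfzDr ?pnatr_eq0// -mulrA; elim: j m => [|j IH] m.
  by exists m; rewrite expr0z mul1r.
have [M HM] := IH (4 * m + b%:Z); exists M; rewrite -HM; congr (_ * _).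
rewrite -!exprnP exprSr -mulrA; congr (_ * _).
rewrite rmorphD rmorphM/=; case: b {IH HM} => /=; [by field|by rewrite mulr0z; field].
Qed.

(** In each coordinate both endpoints of the coarse interval, with indices [M] and [N] on the fine
    lattice, are fine lattice points. A fine interval meeting the coarse one therefore cannot cross
    them. *)
Lemma cell_nested t d e (x : n.-tuple R) : d.1 <= e.1 -> cell t d x ->
  cell t e x -> cell t d `<=` cell t e.
Proof.
move=> de /cellP xd /cellP xe y /cellP yd; apply/cellP => i.
have [j ej] : exists j : nat, e.1 = d.1 + j%:Z.
  by exists `|e.1 - d.1|%N; rewrite gez0_abs ?subr_ge0// subrKC.
have [M EM] := refine_grid (t i) d.1 j (tnth e.2 i).
have [N EN] := refine_grid (t i) d.1 j (tnth e.2 i + 1).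
have k0 := exp4_gt0 d.1.
have /andP[xd1 xd2] := xd i; have /andP[yd1 yd2] := yd i.
have /andP[xe1] := xe i.
rewrite -(addrA _ _ 1) (addrC _ 1) (addrA _ 1) -(intrD _ _ 1) in xd2 yd2 *.
rewrite -(addrA _ _ 1) (addrC _ 1) (addrA _ 1) -(intrD _ _ 1).
move: xe1; rewrite ej EM EN => xe1 xe2.
have := le_lt_trans xe1 xd2; rewrite ltr_pM2l// ltrD2r ltr_int ltzD1 => Mm.
have := le_lt_trans xd1 xe2; rewrite ltr_pM2l// ltrD2r ltr_int => mN.
apply/andP; split.
  by apply: le_trans yd1; rewrite ler_pM2l// lerD2r ler_int.
by apply: lt_le_trans yd2 _; rewrite ler_pM2l// lerD2r ler_int lezD1.
Qed.

Lemma cell_laminar t d e : [\/ cell t d `<=` cell t e,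
  cell t e `<=` cell t d | cell t d `&` cell t e = set0].
Proof.
have [[x [xd xe]]|no] := pselect (exists x, cell t d x /\ cell t e x).
  have [de|/ltW ed] := leP d.1 e.1.
    by apply: Or31; exact: cell_nested de xd xe.
  by apply: Or32; exact: cell_nested ed xe xd.
by apply: Or33; apply/seteqP; split=> // x [xd xe]; apply: no; exists x.
Qed.

Lemma cell_inj t d e : d.1 = e.1 -> cell t e (corner t d) -> d = e.
Proof.
move: d e => [k m] [k' m'] /= <- /cellP /= H; congr pair; apply: eq_from_tnth => i.
have := H i; rewrite tnth_mktuple/= ler_pM2l ?exp4_gt0// ltr_pM2l ?exp4_gt0//.
rewrite -(addrA _ _ 1) (addrC _ 1) (addrA _ 1) -(intrD _ _ 1).
rewrite lerD2r ltrD2r ler_int ltr_int ltzD1 => /andP[? ?].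
by apply/eqP; rewrite eq_le; apply/andP.
Qed.

(** Comparing measures gives [4 ^ d.1 <= 4 ^ e.1]. At equal scales the corner of [d] would lie in
    cell [e], forcing [d = e]; distinct powers of 4 differ by a factor of at least 4. *)
Lemma cell_strict t d e : (0 < n)%N -> d != e -> cell t d `<=` cell t e ->
  (4 : R) ^ d.1 <= 4 ^ e.1 / 4.
Proof.
move=> n0 de sub; have lt4 (k l : int) : k < l -> (4 : R) ^ k <= 4 ^ l / 4.
  move=> kl; rewrite ler_pdivlMr// -[X in _ * X]expr1z -expfzDr ?pnatr_eq0//.
  by rewrite ler_weXz2l ?ler1n// lezD1.
have := le_lebesgue_Rn sub; rewrite !lebesgue_Rn_hcube ?exp4_gt0// lee_fin.
rewrite ler_pXn2r// ?nnegrE ?(ltW (exp4_gt0 _))// => le.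
have [/lt4//|ed] := ltP d.1 e.1.
suff e1 : d.1 = e.1.
  by move/eqP: de; case; apply: cell_inj e1 _; apply: sub; exact: corner_cell.
apply/eqP; rewrite eq_le ed andbT leNgt; apply/negP => /lt4.
have := exp4_gt0 d.1; have := le; lra.
Qed.

Lemma scale_exists (l : R) : 0 < l -> exists k : int, 3 * l < 4 ^ k <= 12 * l.
Proof.
move=> l0; have ln4 : 0 < ln (4 : R) by rewrite ln_gt0// ltr1n.
have l30 : 0 < 3 * l by rewrite mulr_gt0.
have [y E] : exists y, 4 `^ y = 3 * l.
  exists (ln (3 * l) / ln 4).
  by rewrite /powR (_ : (4 : R) == 0 = false) ?pnatr_eq0// divfK ?gt_eqF// lnK.
(* With [4 ^ y = 3 l], this integer [k] satisfies [y < k <= y + 1]. *)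
exists (Num.floor y + 1).
rewrite -E -powR_intmul//; apply/andP; split.
  by rewrite /powR pnatr_eq0/= ltr_expR ltr_pM2r// floorD1_gt.
rewrite (_ : 12 * l = 4 * (3 * l)); last by ring.
rewrite -E intrD mulr1z powRD; last by rewrite pnatr_eq0 implybT.
rewrite powRr1// mulrC ler_pM2l//.
by apply: ler_powR; [rewrite ler1n|exact: Num.Theory.floor_le].
Qed.

(** The one-third trick, coordinate by coordinate. After rescaling, the side is an interval of
    length below 1/3. If it stays before the next integer, the unshifted grid contains it; otherwise
    it starts at fractional part above 2/3 and ends before 4/3, so it fits in the interval shifted
    by 1/3. *)
Lemma cell_cover (a : n.-tuple R) (l : R) : 0 < l ->
  exists t d, cube a l `<=` cell t d /\ 4 ^ d.1 <= 12 * l.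
Proof.
move=> l0; have [k /andP[lk kl]] := scale_exists l0.
have k0 := exp4_gt0 k.
pose u i := tnth a i / 4 ^ k.
pose b i := 1 <= u i - (Num.floor (u i))%:~R + l / 4 ^ k.
exists [ffun i => b i], (k, [tuple Num.floor (u i) | i < n]); split=> //= x xa.
apply/cellP => i /=; rewrite tnth_mktuple ffunE.
have /andP[] := xa i.
have -> : tnth a i = u i * 4 ^ k by rewrite /u divfK ?gt_eqF//.
have v3 : l / 4 ^ k < 3^-1 by rewrite ltr_pdivrMr// ltr_pdivlMl.
have v0 : 0 < l / 4 ^ k by rewrite divr_gt0.
have -> : u i * 4 ^ k + l = (u i + l / 4 ^ k) * 4 ^ k.
  by rewrite mulrDl [l / _ * _]divfK ?gt_eqF//.
have := floor_itv (u i); rewrite intrD mulr1z => /andP[f1 f2] h1 h2.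
apply/andP; split.
  apply: le_trans h1; rewrite mulrC ler_pM2r// /b.
  by have [?|?] := leP 1 (u i - (Num.floor (u i))%:~R + l / 4 ^ k) => /=; lra.
apply: le_lt_trans h2 _; rewrite mulrC ltr_pM2l// /b.
by have [?|?] := leP 1 (u i - (Num.floor (u i))%:~R + l / 4 ^ k) => /=; lra.
Qed.

End grids.

(** * Superlevel sets and weights *)

(** Countable subadditivity along an enumeration of the index type. It reduces a cover by all cells
    to finite families, to which the embedding applies. *)
Lemma outer_measure_countable_le (T : Type) (R : realType)
    (mu : {outer_measure set T -> \bar R}) (D : countType) (U : D -> set T) b :
  (forall J : seq D, uniq J -> \sum_(i <- J) mu (U i) <= b) ->
  mu (\bigcup_i U i) <= b.
Proof.
move=> Hb; pose F k := if pickle_inv k is Some i then U i else set0.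
have -> : \bigcup_i U i = \bigcup_k F k.
  apply/seteqP; split=> [x [i _ xi]|x [k _]].
    by exists (pickle i) => //; rewrite /F pickleK_inv.
  by rewrite /F; case: pickle_inv => // i xi; exists i.
apply: le_trans (outer_measure_sigma_subadditive mu F) _.
apply: lime_le; first by apply: is_cvg_nneseries => k _ _; exact: outer_measure_ge0.
apply: nearW => N.
have -> : \sum_(0 <= k < N) mu (F k) =
    \sum_(i <- pmap pickle_inv (index_iota 0 N)) mu (U i).
  elim: (index_iota 0 N) => [|k s IH]; first by rewrite !big_nil.
  rewrite big_cons IH /= /F; case: pickle_inv => [i|] /=.
    by rewrite big_cons.
  by rewrite outer_measure0 add0e.
by apply: Hb; apply: (pmap_uniq pickle_invK); exact: iota_uniq.
Qed.

Lemma ge0_integral_ge d (T : measurableType d) (R : realType)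
    (mu : {measure set T -> \bar R}) (E F : set T) (h : T -> R) (c : R) :
  measurable E -> measurable F -> F `<=` E -> measurable_fun setT h ->
  (forall x, 0 <= h x)%R -> (0 <= c)%R -> (forall x, F x -> c <= h x)%R ->
  c%:E * mu F <= \int[mu]_(x in E) (h x)%:E.
Proof.
move=> mE mF FE mh h0 c0 ch.
have mhE : measurable_fun E (fun x => (h x)%:E).
  by apply/measurable_EFinP; exact: measurable_funS mh.
apply: (@le_trans _ _ (\int[mu]_(x in F) (h x)%:E)); last first.
  by apply: ge0_subset_integral => // x _; rewrite lee_fin.
rewrite -integral_cst//; apply: ge0_le_integral => //.
by apply: measurable_funS mhE.
Qed.

Section weights_facts.
Context {R : realType} {n : nat}.
Local Notation mu := (@lebesgue_Rn R n).
Implicit Types (w f : Rn R n -> R) (Q : set (Rn R n)) (p q : R).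

Lemma lebesgue_Rn_countable_le (D : countType) (U : D -> set (Rn R n)) b :
  (forall J : seq D, uniq J -> \sum_(i <- J) mu (U i) <= b) ->
  mu (\bigcup_i U i) <= b.
Proof. exact: (@outer_measure_countable_le _ R (borel_lebesgue R n)^*%mu). Qed.

Lemma weak_Lnorm_ge (r lambda : R) (g : Rn R n -> \bar R) : (0 < lambda)%R ->
  lambda%:E * mu [set x | lambda%:E < `|g x|] `^ r^-1 <= weak_Lnorm r g.
Proof. by move=> l0; apply: ereal_sup_ubound; exists lambda. Qed.

Lemma weak_Lnorm_ge0 (r : R) (g : Rn R n -> \bar R) : 0 <= weak_Lnorm r g.
Proof.
apply: le_trans (weak_Lnorm_ge r g (ltr01 : 0 < 1 :> R)%R).
by rewrite mule_ge0// poweR_ge0.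
Qed.

Lemma superlevel_le w q Q (u : R) : (0 < q)%R -> (0 < u)%R ->
  (u `^ q)%:E * mu (Q `&` [set x | u < w x]%R) <=
  weak_Lnorm 1 (fun x => (w x `^ q * \1_Q x)%:E).
Proof.
move=> q0 u0; apply: le_trans (weak_Lnorm_ge 1 _ (powR_gt0 q u0)).
rewrite invr1 poweRe1 ?measure_ge0// lee_wpmul2l ?lee_fin ?powR_ge0//.
apply: le_lebesgue_Rn => x [Qx ux] /=; rewrite indicE mem_set// mulr1.
rewrite lte_fin ger0_norm ?powR_ge0//; apply: gt0_ltr_powR => //.
  by rewrite nnegrE ltW.
by rewrite nnegrE ltW// (lt_trans u0).
Qed.

(** The set where [w > 0] is exhausted by the sets where [w > 1 / (k + 1)], each of them null by the
    weak bound. *)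
Lemma weak_Lnorm_eq0 w q Q : (0 < q)%R ->
  weak_Lnorm 1 (fun x => (w x `^ q * \1_Q x)%:E) = 0 ->
  mu (Q `&` [set x | 0 < w x]%R) = 0.
Proof.
move=> q0 W0; apply/eqP; rewrite eq_le measure_ge0 andbT.
pose U (k : nat) := Q `&` [set x | k.+1%:R^-1 < w x]%R.
apply: (@le_trans _ _ (mu (\bigcup_k U k))).
  apply: le_lebesgue_Rn => x [Qx /= wx].
  have [k] := ltr_add_invr wx; rewrite add0r => kw; exists k => //.
apply: lebesgue_Rn_countable_le => J _; rewrite big1// => k _.
have k0 : (0 < k.+1%:R^-1 :> R)%R by rewrite invr_gt0.
apply/eqP; rewrite eq_le measure_ge0 andbT.
have := superlevel_le w Q q0 k0; rewrite W0.
by rewrite pmule_rle0// lte_fin powR_gt0.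
Qed.

Lemma integral_gt0 (h : Rn R n -> R) Q : measurable Q -> measurable_fun setT h ->
  (forall x, 0 < h x)%R -> 0 < mu Q -> 0 < \int[mu]_(x in Q) (h x)%:E.
Proof.
move=> mQ mh h0 muQ; rewrite lt_neqAle integral_ge0 ?andbT; last first.
  by move=> x _; rewrite lee_fin ltW.
apply/negP => /eqP/esym I0.
have : ae_eq mu Q (fun x => (h x)%:E) (cst 0).
  apply/ae_eq_integral_abs => //.
    by apply/measurable_EFinP; exact: measurable_funS mh.
  rewrite -{}I0; apply: eq_integral => x _; rewrite gee0_abs// lee_fin ltW//.
case=> N [mN N0 QN]; move: muQ; rewrite ltNge => /negP; apply.
rewrite -N0; apply: le_measure; rewrite ?inE// => x Qx; apply: QN => /=.
by move=> /(_ Qx)[] hx; have := h0 x; rewrite hx ltxx.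
Qed.

End weights_facts.

(** * Consequences of the weight condition for a positive weight *)

Section positive_weights.
Context {R : realType} {n : nat}.
Local Notation mu := (@lebesgue_Rn R n).
Context (p q : R) (w : Rn R n -> R) (K : R).
Hypothesis p1 : (1 < p)%R.
Hypothesis q0 : (0 < q)%R.
Hypothesis mw : measurable_fun setT w.
Hypothesis w0 : forall x, (0 < w x)%R.
Hypothesis wK : Apq_star_const p q w <= K%:E.
Local Notation p' := (conjugate_exponent p).
Local Notation sg := (fun x => w x `^ (- p'))%R.

Lemma conjugate_gt0 : (0 < p')%R.
Proof. by have := p1; rewrite /conjugate_exponent => ?; apply: divr_gt0; lra. Qed.

Lemma sg_gt0 x : (0 < sg x)%R.
Proof. exact: powR_gt0. Qed.

Lemma measurable_sg : measurable_fun setT sg.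
Proof. exact: measurable_fun_powR. Qed.

(** Turns the condition on one cube into real numbers: [W] is the weak norm of [w ^ q] and [S] the
    mass of the dual weight. As [w > 0], both are positive, so an infinite value of one would make
    the product infinite, against the bound [K]. *)
Lemma Apq_cube (a : n.-tuple R) (l : R) : (0 < l)%R ->
  exists W S : R, [/\ (0 < W)%R, (0 < S)%R,
    \int[mu]_(x in cube a l) (sg x)%:E = S%:E,
    forall u, (0 < u)%R ->
      mu (cube a l `&` [set x | u < w x]%R) <= (W / u `^ q)%:E &
    ((W / l ^+ n) `^ q^-1 * (S / l ^+ n) `^ p'^-1 <= K)%R].
Proof.
move=> l0; have p'0 := conjugate_gt0; pose Q := cube a l.
have V0 : (0 < l ^+ n)%R by rewrite exprn_gt0.
have muQ : mu Q = (l ^+ n)%:E by exact: lebesgue_Rn_cube.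
have mQ : measurable Q by exact: measurable_cube.
pose W := weak_Lnorm 1 (fun x => (w x `^ q * \1_Q x)%:E).
pose S := \int[mu]_(x in Q) (sg x)%:E.
have W0 : 0 < W.
  rewrite lt_neqAle weak_Lnorm_ge0 andbT; apply/negP => /eqP/esym.
  move=> /(weak_Lnorm_eq0 q0); rewrite (_ : _ `&` _ = Q) ?muQ.
    by move/eqP; rewrite eqe gt_eqF.
  by apply/seteqP; split=> [x []|x Qx]//; split=> //=.
have S0 : 0 < S.
  apply: integral_gt0; [exact: mQ|exact: measurable_sg|exact: sg_gt0|].
  by rewrite muQ lte_fin.
have iV0 : 0 < (l ^+ n)%:E^-1 by rewrite inver gt_eqF// lte_fin invr_gt0.
have : ((mu Q)^-1 * W) `^ q^-1 * ((mu Q)^-1 * S) `^ p'^-1 <= K%:E.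
  apply: le_trans wK; apply: ereal_sup_ubound; exists Q; first by exists a, l.
  congr (_ * (_ * _) `^ _); apply: eq_integral => x _.
  by rewrite inver powRN gt_eqF// powR_gt0.
rewrite muQ => WSK.
have Wfin : W \is a fin_num.
  rewrite ge0_fin_numE ?(ltW W0)// ltey; apply/eqP => Woo.
  move: WSK; rewrite Woo gt0_muley// poweRyr; last by rewrite gt_eqF// invr_gt0.
  by rewrite gt0_mulye// poweR_gt0// mule_gt0.
have Sfin : S \is a fin_num.
  rewrite ge0_fin_numE ?(ltW S0)// ltey; apply/eqP => Soo.
  move: WSK; rewrite Soo [X in _ * X `^ _]gt0_muley// poweRyr; last first.
    by rewrite gt_eqF// invr_gt0.
  by rewrite gt0_muley// poweR_gt0// mule_gt0.
exists (fine W), (fine S); split.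
- by rewrite -lte_fin fineK.
- by rewrite -lte_fin fineK.
- by rewrite fineK.
- move=> u u0; have uq0 : (0 < u `^ q)%R by rewrite powR_gt0.
  have := superlevel_le w Q q0 u0; rewrite -/W -(fineK Wfin).
  by rewrite -lee_pdivlMl// -EFinM mulrC.
- move: WSK; rewrite -(fineK Wfin) -(fineK Sfin) inver gt_eqF// -!EFinM.
  by rewrite lee_fin /= ![(l ^- n * _)%R]mulrC.
Qed.

(** On the part [F] of [E] where [w <= u] the dual weight is at least [u ^ (- p')], and [F] has at
    least half the measure of the cube. The weight condition bounds the mean of the dual weight by
    [B * u ^ (- p')], whence [c = 1 / (2 (B + 1))]. *)
Lemma Apq_absolutely_continuous : exists2 c : R, (0 < c < 1)%R &
  forall (a : n.-tuple R) (l : R) (E : set (Rn R n)), (0 < l)%R ->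
  measurable E -> E `<=` cube a l -> (3 / 4 * l ^+ n)%:E <= mu E ->
  c%:E * \int[mu]_(x in cube a l) (sg x)%:E <= \int[mu]_(x in E) (sg x)%:E.
Proof.
have p'0 := conjugate_gt0.
have K0 : (0 <= K)%R.
  have [W [S [W0 S0 _ _]]] := Apq_cube [tuple 0%R | _ < n] (ltr01 : 0 < 1 :> R)%R.
  by apply: le_trans; rewrite mulr_ge0// powR_ge0.
set B := ((4 `^ q^-1 * (K + 1)) `^ p')%R.
have B0 : (0 < B)%R by rewrite powR_gt0// mulr_gt0// ?powR_gt0//; lra.
have c0 : (0 < (2 * (B + 1))^-1)%R by rewrite invr_gt0; lra.
exists ((2 * (B + 1))^-1)%R.
  by rewrite c0 invf_lt1//; lra.
move=> a l E l0 mE EQ muE.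
have [W [S [W0 S0 SE lev WSK]]] := Apq_cube a l0.
have V0 : (0 < l ^+ n)%R by rewrite exprn_gt0.
set V := (l ^+ n)%R in V0 WSK muE.
(* The level at which the weak bound [W / u ^ q] equals [V / 4]. *)
pose u := ((4 * W / V) `^ q^-1)%R.
have W40 : (0 < 4 * W / V)%R by rewrite divr_gt0// mulr_gt0.
have u0 : (0 < u)%R by rewrite powR_gt0.
have uq : (u `^ q = 4 * W / V)%R.
  by rewrite -powRrM mulVf ?gt_eqF// powRr1// ltW.
pose F := E `&` [set x | w x <= u]%R.
have mlow : measurable [set x | w x <= u]%R.
  rewrite (_ : [set x | _] = w @^-1` `]-oo, u]%classic); last first.
    by apply/seteqP; split=> x /=; rewrite in_itv.
  by rewrite -[X in measurable X]setTI; apply: mw.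
have mF : measurable F by exact: measurableI.
have muF : (V / 2)%:E <= mu F.
  have : mu E <= mu F + mu (cube a l `&` [set x | u < w x]%R).
    apply: le_trans (outer_measureU2 (borel_lebesgue R n)^*%mu _ _).
    apply: le_lebesgue_Rn => x Ex; have [xu|xu] := leP (w x) u; first by left.
    by right; split=> //; exact: EQ.
  move=> /(le_trans muE) /le_trans/(_ (leeD2l _ (lev u u0))).
  rewrite uq (_ : (W / (4 * W / V))%R = (V / 4)%R); last first.
    by field; rewrite !gt_eqF.
  have := @measure_ge0 _ _ _ mu F; case: (mu F) => [m| |]//.
    by rewrite -EFinD !lee_fin; lra.
  by move=> _ _; exact: leey.
apply: (@le_trans _ _ ((u `^ (- p'))%:E * mu F)); last first.
  apply: (@ge0_integral_ge _ _ _ mu E F sg _ mE mF).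
  - exact: subIsetl.
  - exact: measurable_sg.
  - by move=> x; exact: powR_ge0.
  - exact: powR_ge0.
  move=> x [_ /= xu]; rewrite !powRN lef_pV2 ?posrE ?powR_gt0//.
  by apply: ler_powR_base; [exact: ltW|exact: ltW|].
apply: (@le_trans _ _ ((u `^ (- p'))%:E * (V / 2)%:E)); last first.
  by rewrite lee_wpmul2l// lee_fin powR_ge0.
rewrite SE -!EFinM lee_fin powRN.
have up0 : (0 < u `^ p')%R by rewrite powR_gt0.
rewrite ler_pdivlMl// mulrCA ler_pdivrMl; last by lra.
rewrite (_ : (2 * (B + 1) * (V / 2) = B * V + V)%R); last by field.
(* Up to the factor [4 ^ (1/q)], [u] is the first factor of the weight condition; [K + 1] replaces
   [K] only to keep [B] positive. *)
have H : (u * (S / V) `^ p'^-1 <= 4 `^ q^-1 * (K + 1))%R.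
  rewrite /u -mulrA powRM ?(ltW (divr_gt0 _ _))// -mulrA ler_wpM2l ?powR_ge0//.
  by apply: le_trans WSK _; rewrite lerDl.
have : (u `^ p' * (S / V) <= B)%R.
  have SV : (0 <= S / V)%R by rewrite ltW// divr_gt0.
  have -> : (S / V = ((S / V) `^ p'^-1) `^ p')%R.
    by rewrite -powRrM mulVf ?gt_eqF// powRr1.
  rewrite -powRM ?(ltW u0) ?powR_ge0//; apply: ler_powR_base => //.
    exact: ltW.
  by rewrite mulr_ge0 ?powR_ge0// ltW.
by rewrite mulrA ler_pdivrMr// => /le_trans; apply; rewrite lerDl ltW.
Qed.

End positive_weights.

(** * Arithmetic of the exponents *)

Section exponents.
Local Open Scope ring_scope.
Context {R : realType} (n : nat) (alpha p q : R).
Hypothesis alpha_n : 0 < alpha < n%:R.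
Hypothesis p_lt : 1 < p < n%:R / alpha.
Hypothesis pq : p^-1 - q^-1 = alpha / n%:R.

Lemma dim_gt0 : 0 < n%:R :> R.
Proof. by case/andP: alpha_n; exact: lt_trans. Qed.

Lemma q_gt0 : 0 < q.
Proof.
have n0 := dim_gt0; have /andP[a0 an] := alpha_n; have /andP[p1 pn] := p_lt.
have p0 : 0 < p by lra.
rewrite -invr_gt0.
have -> : q^-1 = p^-1 - alpha / n%:R by rewrite -pq; lra.
by rewrite subr_gt0 -invf_div ltf_pV2 ?posrE// divr_gt0.
Qed.

Lemma q_div_p_gt1 : 1 < q / p.
Proof.
have n0 := dim_gt0; have q0 := q_gt0.
have /andP[a0 an] := alpha_n; have /andP[p1 pn] := p_lt.
have p0 : 0 < p by lra.
rewrite ltr_pdivlMr// mul1r -ltf_pV2 ?posrE// -subr_gt0 pq.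
by rewrite divr_gt0.
Qed.

Lemma conjugate_inv : (conjugate_exponent p)^-1 = 1 - p^-1.
Proof.
have /andP[p1 _] := p_lt.
by rewrite /conjugate_exponent; field; apply/andP; split; rewrite gt_eqF//; lra.
Qed.

(** In the weight condition the powers of the side [h] collect to [n (1/p - 1/q) - n = alpha - n].
    Multiplying by [v * s ^ (1/p)] and raising to the power [q] gives the claim, because the two
    powers of [s] combine to [s] itself. *)
Lemma level_exponent (K h W s v : R) : 0 < h -> 0 < W -> 0 < s -> 0 <= v ->
  (W / h ^+ n) `^ q^-1 * (s / h ^+ n) `^ (conjugate_exponent p)^-1 <= K ->
  W * (h `^ (alpha - n%:R) * (v * s)) `^ q <= K `^ q * (v `^ p * s) `^ (q / p).
Proof.
move=> h0 W0 s0 v0; have n0 := dim_gt0; have q0 := q_gt0.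
have /andP[a0 an] := alpha_n; have /andP[p1 pn] := p_lt.
have p0 : 0 < p by lra.
rewrite conjugate_inv; set e := 1 - p^-1.
have hn0 : 0 < h ^+ n by rewrite exprn_gt0.
move=> HK; rewrite !powRM ?invr_ge0 ?(ltW W0) ?(ltW s0) ?(ltW hn0)// in HK.
rewrite -!(powR_inv1 (ltW hn0)) -!powRrM !mulN1r in HK.
rewrite -(powR_mulrn _ (ltW h0)) -!powRrM in HK.
have K0 : 0 <= K by apply: le_trans HK; rewrite !mulr_ge0 ?powR_ge0.
have HK' : W `^ q^-1 * s `^ e * h `^ (alpha - n%:R) <= K.
  apply: le_trans HK; rewrite mulrACA -powRD; last by rewrite (gt_eqF h0) implybT.
  rewrite ler_wpM2l ?mulr_ge0 ?powR_ge0//.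
  rewrite (_ : _ + _ = alpha - n%:R)//.
  have -> : alpha = n%:R * (p^-1 - q^-1) by rewrite pq mulrC divfK ?gt_eqF.
  by rewrite /e; ring.
have -> : W * (h `^ (alpha - n%:R) * (v * s)) `^ q =
    (W `^ q^-1 * s `^ e * h `^ (alpha - n%:R) * (v * s `^ p^-1)) `^ q.
  have -> : W `^ q^-1 * s `^ e * h `^ (alpha - n%:R) * (v * s `^ p^-1) =
      W `^ q^-1 * (h `^ (alpha - n%:R) * (v * (s `^ e * s `^ p^-1))) by ring.
  rewrite -powRD; last by rewrite (gt_eqF s0) implybT.
  rewrite subrK powRr1 ?(ltW s0)// [RHS]powRM ?powR_ge0//.
    by rewrite -powRrM mulVf ?gt_eqF// powRr1// ltW.
  by rewrite !mulr_ge0 ?powR_ge0// ltW.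
have -> : (v `^ p * s) `^ (q / p) = (v * s `^ p^-1) `^ q.
  rewrite !powRM ?powR_ge0 ?(ltW s0)// -!powRrM.
  rewrite (_ : p * (q / p) = q); last by field; rewrite gt_eqF.
  by rewrite (mulrC q).
rewrite -powRM ?mulr_ge0 ?powR_ge0//; apply: ler_powR_base; first exact: ltW.
  by rewrite !mulr_ge0 ?powR_ge0.
by rewrite ler_wpM2r// mulr_ge0 ?powR_ge0.
Qed.

End exponents.

(** * Sufficiency *)

Section sufficiency.
Context {R : realType} {n : nat} (alpha p q : R) (w : Rn R n -> R) (K : R).
Local Notation mu := (@lebesgue_Rn R n).
Local Notation index := ({ffun 'I_n -> bool} * (int * n.-tuple int))%type.
Local Notation p' := (conjugate_exponent p).
Local Notation sg := (fun x => w x `^ (- p'))%R.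
Hypothesis alpha_n : (0 < alpha < n%:R)%R.
Hypothesis p_lt : (1 < p < n%:R / alpha)%R.
Hypothesis pq : (p^-1 - q^-1 = alpha / n%:R)%R.
Hypothesis mw : measurable_fun setT w.
Hypothesis w0 : forall x, (0 < w x)%R.
Hypothesis wK : Apq_star_const p q w <= K%:E.

Let n0 : (0 < n%:R :> R)%R := dim_gt0 alpha_n.
Let q0 : (0 < q)%R := q_gt0 alpha_n p_lt pq.
Let p1 : (1 < p)%R. Proof. by case/andP: p_lt. Qed.

Definition icell (i : index) : set (Rn R n) := cell i.1 i.2.
Definition scale (i : index) : R := (4 ^ i.2.1)%R.

Lemma scale_gt0 i : (0 < scale i)%R. Proof. exact: exp4_gt0. Qed.

Lemma measurable_icell i : measurable (icell i).
Proof. exact: measurable_hcube. Qed.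

Lemma lebesgue_icell i : mu (icell i) = (scale i ^+ n)%:E.
Proof. exact: (lebesgue_Rn_hcube _ (scale_gt0 i)). Qed.

Lemma icell_sub_cube i : icell i `<=` cube (corner i.1 i.2) (scale i).
Proof. exact: hcube_sub_cube. Qed.

(** A cube of side [l] witnessing the level lies in a cell of scale at most [12 l]. Passing to the
    cell increases the integral of [|f|] and costs at most [12 ^ (n - alpha)] in the
    normalization. *)
Lemma level_cover (f : Rn R n -> R) (a : index -> R) (lambda : R) :
  measurable_fun setT f -> (0 < lambda)%R ->
  (forall i, \int[mu]_(x in icell i) `|f x|%:E = (a i)%:E) ->
  [set x | lambda%:E < `|(w x)%:E * fractional_maximal alpha f x|] `<=`
  \bigcup_i (icell i `&` [set x | lambda < w x *
    (12 `^ (n%:R - alpha) * (scale i `^ (alpha - n%:R) * a i))]%R).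
Proof.
move=> mf l0 aE x /=.
have M0 : 0 <= fractional_maximal alpha f x.
  pose Q0 := cube [tuple (0 : R)%R | _ < n] 1.
  apply: (@le_trans _ _ (mu Q0 `^ (alpha / n%:R) *
      ((mu Q0)^-1 * \int[mu]_(y in Q0) `|f y|%:E) * (\1_Q0 x)%:E)).
    rewrite mule_ge0 ?lee_fin// mule_ge0 ?poweR_ge0// mule_ge0//.
      by rewrite inve_ge0 measure_ge0.
    by apply: integral_ge0 => y _; rewrite lee_fin.
  apply: ereal_sup_ubound; exists Q0 => //.
  by exists [tuple (0 : R)%R | _ < n], 1%R.
rewrite gee0_abs; last by rewrite mule_ge0// lee_fin ltW.
rewrite -lte_pdivrMl// => /ereal_sup_gt[_ [Q [b [l [l0' QE]]] <-]].
have muQ : mu Q = (l ^+ n)%:E by rewrite QE; exact: lebesgue_Rn_cube.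
have V0 : (0 < l ^+ n)%R by rewrite exprn_gt0.
have [xQ|xQ] := boolP (x \in Q); last first.
  rewrite indicE (negbTE xQ) mule0 -EFinM lte_fin.
  by rewrite ltNge mulr_ge0// ?invr_ge0 ltW.
rewrite indicE xQ mule1.
have [t [d [Qd dl]]] := cell_cover b l0'.
pose i : index := (t, d); rewrite -QE in Qd.
have mQ : measurable Q by rewrite QE; exact: measurable_cube.
have Qa : \int[mu]_(y in Q) `|f y|%:E <= (a i)%:E.
  rewrite -aE; apply: ge0_subset_integral.
  - exact: mQ.
  - exact: measurable_icell.
  - exact/measurable_EFin_restrict/measurable_fun_norm.
  - by move=> y _; rewrite lee_fin.
  - exact: Qd.
rewrite muQ poweR_EFin inver gt_eqF// => H.
exists i; first by [].
split; first by apply: Qd; exact/set_mem.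
have a0 : (0 <= a i)%R.
  by rewrite -lee_fin -aE; apply: integral_ge0 => y _; rewrite lee_fin.
have {}H : (w x)^-1%:E * lambda%:E <
    (((l ^+ n) `^ (alpha / n%:R))%R)%:E * ((l ^- n)%:E * (a i)%:E).
  apply: lt_le_trans H _; apply: lee_wpmul2l; first by rewrite lee_fin powR_ge0.
  by apply: lee_wpmul2l => //; rewrite lee_fin invr_ge0 ltW.
rewrite -!EFinM lte_fin ltr_pdivrMl// in H.
apply: lt_le_trans H _; rewrite ler_pM2l// mulrA [leRHS]mulrA ler_wpM2r//.
have [a_gt0 an] := andP alpha_n.
have -> : ((l ^+ n) `^ (alpha / n%:R) / l ^+ n = l `^ (alpha - n%:R))%R.
  rewrite -(powR_mulrn _ (ltW l0')) -powRrM mulrC [(n%:R * _)%R]mulrC divfK ?gt_eqF//.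
  by rewrite mulrC powRB// (gt_eqF l0') implybT.
have -> : (scale i `^ (alpha - n%:R) = (scale i `^ (n%:R - alpha))^-1)%R.
  by rewrite -powRN opprB.
have -> : (l `^ (alpha - n%:R) = (l `^ (n%:R - alpha))^-1)%R by rewrite -powRN opprB.
have si0 : (0 < scale i `^ (n%:R - alpha))%R by rewrite powR_gt0// scale_gt0.
rewrite ler_pdivlMr// mulrC ler_pdivrMr ?powR_gt0// -powRM// ?(ltW l0')//.
by apply: ler_powR_base; [rewrite subr_ge0 ltW|exact/ltW/scale_gt0|exact: dl].
Qed.


(** A strictly smaller nested cell has at most a quarter of the side, hence of the measure. The
    difference [E] then has at least 3/4 of the measure, so it keeps a fraction [c] of the dual
    mass. *)
Lemma icell_decay (c : R) (s : index -> R) (i j : index) :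
  (forall (a : n.-tuple R) (l : R) (E : set (Rn R n)), (0 < l)%R ->
    measurable E -> E `<=` cube a l -> (3 / 4 * l ^+ n)%:E <= mu E ->
    c%:E * \int[mu]_(x in cube a l) (sg x)%:E <= \int[mu]_(x in E) (sg x)%:E) ->
  (0 <= c)%R -> (forall i, \int[mu]_(x in icell i) (sg x)%:E = (s i)%:E) ->
  i.1 = j.1 -> i != j -> icell i `<=` icell j -> (s i <= (1 - c) * s j)%R.
Proof.
move=> ac c0 sE ij neq sub.
have n_gt0 : (0 < n)%N by rewrite -(ltr0n R).
have ij2 : i.2 != j.2.
  by apply: contra_neq neq => ij2; move: i j ij ij2 {sub} => [? ?] [? ?] /= -> ->.
have sc : (scale i <= scale j / 4)%R.
  by apply: (@cell_strict _ _ i.1) => //; move: sub; rewrite /icell -ij.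
have sc0 := scale_gt0 j.
have V4 : (scale i ^+ n <= scale j ^+ n / 4)%R.
  apply: (@le_trans _ _ ((scale j / 4) ^+ n)%R).
    by rewrite lerXn2r ?nnegrE ?(ltW (scale_gt0 _)) ?divr_ge0// ltW.
  rewrite expr_div_n ler_pM2l ?exprn_gt0// lef_pV2 ?posrE ?exprn_gt0//.
  by rewrite -[leLHS]expr1 ler_eXn2l// ltr1n.
pose E := icell j `\` icell i.
have mE : measurable E by apply: measurableD; exact: measurable_icell.
have jE : icell j = icell i `|` E by rewrite setDUK.
have muE : (3 / 4 * scale j ^+ n)%:E <= mu E.
  have : mu (icell j) <= mu (icell i) + mu E.
    by rewrite {1}jE; exact: (outer_measureU2 (borel_lebesgue R n)^*%mu).
  rewrite !lebesgue_icell; have := @measure_ge0 _ _ _ mu E.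
  case: (mu E) => [m| |]//; last by move=> _ _; exact: leey.
  by rewrite -EFinD !lee_fin => _; move: V4; lra.
have EQ : E `<=` cube (corner j.1 j.2) (scale j).
  by move=> x [/icell_sub_cube].
have := ac _ _ _ sc0 mE EQ muE.
have msg : measurable_fun setT (fun x => (sg x)%:E).
  by apply/measurable_EFinP; exact: measurable_sg.
have sg0 x : 0 <= (sg x)%:E by rewrite lee_fin powR_ge0.
have -> : \int[mu]_(x in E) (sg x)%:E = (s j - s i)%:E.
  have := sE j; rewrite [in LHS]jE.
  rewrite (@ge0_integral_setU _ _ _ mu _ _ (measurable_icell i) mE); first last.
  - by rewrite disj_set2E setDIK.
  - by [].
  - exact: measurable_funS msg.
  rewrite sE; have : 0 <= \int[mu]_(x in E) (sg x)%:E by exact: integral_ge0.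
  case: (\int[mu]_(x in E) _) => [z| |]// _ [<-].
  by rewrite addrAC subrr add0r.
have : (s j)%:E <= \int[mu]_(x in cube (corner j.1 j.2) (scale j)) (sg x)%:E.
  rewrite -sE; apply: ge0_subset_integral.
  - exact: measurable_icell.
  - exact: measurable_cube.
  - exact: measurable_funS msg.
  - by [].
  - exact: icell_sub_cube.
move=> h1 /(le_trans (lee_wpmul2l _ h1)).
by rewrite lee_fin => /(_ c0); rewrite -EFinM lee_fin; lra.
Qed.


(** Pointwise [|f| <= sg + |f| ^ p * sg ^ (1 - p)], according to which of [|f|] and [sg] is larger,
    and both terms are integrable over the cell. *)
Lemma icell_average (f : Rn R n -> R) (phi : Rn R n -> R) (Phi : R) (s : R) i :
  measurable_fun setT f -> measurable_fun setT phi ->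
  (forall x, phi x = `|f x| `^ p * sg x `^ (1 - p))%R ->
  \int[mu]_x (phi x)%:E = Phi%:E -> \int[mu]_(x in icell i) (sg x)%:E = s%:E ->
  \int[mu]_(x in icell i) `|f x|%:E \is a fin_num.
Proof.
move=> mf mphi phiE PhiE sE.
have p0 : (0 < p)%R by have := p1; lra.
have p10 : (0 <= p - 1)%R by have := p1; lra.
have phi0 x : (0 <= phi x)%R by rewrite phiE mulr_ge0 ?powR_ge0.
have mi := measurable_icell i.
have msg : measurable_fun setT (fun x => (sg x)%:E).
  by apply/measurable_EFinP; exact: measurable_sg.
have mphie : measurable_fun setT (fun x => (phi x)%:E) by exact/measurable_EFinP.
rewrite ge0_fin_numE; last by apply: integral_ge0 => x _; rewrite lee_fin.
apply: (@le_lt_trans _ _ (\int[mu]_(x in icell i) ((sg x)%:E + (phi x)%:E))).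
  apply: ge0_le_integral.
  - exact: mi.
  - by move=> x _; rewrite lee_fin.
  - exact/measurable_EFin_restrict/measurable_fun_norm.
  - apply: emeasurable_funD.
      exact: measurable_funS msg.
    exact: measurable_funS mphie.
  move=> x _; rewrite -EFinD lee_fin.
  have sgx : (0 < sg x)%R by exact: powR_gt0.
  have [fs|sf] := leP `|f x|%R (sg x); first by rewrite -[leLHS]addr0 lerD.
  rewrite -[leLHS]add0r lerD ?powR_ge0// phiE.
  rewrite -(mulr_powRB1 (normr_ge0 _) p0) -mulrA ler_peMr//.
  have -> : (sg x `^ (1 - p) = (sg x `^ (p - 1))^-1)%R by rewrite -powRN opprB.
  rewrite ler_pdivlMr ?powR_gt0// mul1r.
  by apply: ler_powR_base; [|exact: ltW|exact: ltW].
rewrite ge0_integralD; first last.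
- exact: measurable_funS mphie.
- by move=> x _; rewrite lee_fin.
- exact: measurable_funS msg.
- by move=> x _; rewrite lee_fin powR_ge0.
- exact: mi.
rewrite sE; apply: lte_add_pinfty; first exact: ltry.
apply: le_lt_trans (_ : _ <= \int[mu]_x (phi x)%:E) _; last by rewrite PhiE ltry.
apply: ge0_subset_integral.
- exact: mi.
- exact: measurableT.
- exact: mphie.
- by move=> x _; rewrite lee_fin.
- by [].
Qed.

(** Passes from the closed cube to the half-open cell by monotonicity: [W] still belongs to the
    closed cube, and the dual mass can only decrease. *)
Lemma icell_mass i : exists W s : R, [/\ (0 < s)%R, (0 < W)%R,
  \int[mu]_(x in icell i) (sg x)%:E = s%:E,
  forall u, (0 < u)%R ->
    mu (icell i `&` [set x | u < w x]%R) <= (W / u `^ q)%:E &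
  ((W / scale i ^+ n) `^ q^-1 * (s / scale i ^+ n) `^ p'^-1 <= K)%R].
Proof.
have mi := measurable_icell i.
have [W [S [W0 S0 SE lev WSK]]] :=
  Apq_cube p1 q0 mw w0 wK (corner i.1 i.2) (scale_gt0 i).
have msg : measurable_fun setT sg by exact: measurable_sg.
have V0 : (0 < scale i ^+ n)%R by apply: exprn_gt0; exact: scale_gt0.
have sub : \int[mu]_(x in icell i) (sg x)%:E <= S%:E.
  rewrite -SE; apply: ge0_subset_integral.
  - exact: mi.
  - exact: measurable_cube.
  - exact: measurable_EFin_restrict.
  - by move=> x _; rewrite lee_fin powR_ge0.
  - exact: icell_sub_cube.
have pos : 0 < \int[mu]_(x in icell i) (sg x)%:E.
  apply: integral_gt0 => //; first by move=> x; exact: powR_gt0.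
  by rewrite lebesgue_icell lte_fin.
have sE : \int[mu]_(x in icell i) (sg x)%:E =
    (fine (\int[mu]_(x in icell i) (sg x)%:E))%:E.
  by rewrite fineK// ge0_fin_numE ?(ltW pos)// (le_lt_trans sub)// ltry.
exists W, (fine (\int[mu]_(x in icell i) (sg x)%:E)); split => //.
- by rewrite -lte_fin -sE.
- move=> u u0; apply: le_trans (lev u u0); apply: le_lebesgue_Rn => x [ix ?].
  by split=> //; exact: icell_sub_cube.
apply: le_trans WSK; rewrite ler_wpM2l ?powR_ge0//; apply: ler_powR_base.
- by rewrite invr_ge0 ltW// conjugate_gt0.
- by rewrite divr_ge0 ?(ltW V0)// -lee_fin -sE ltW.
- by rewrite ler_pM2r ?invr_gt0// -lee_fin -sE.
Qed.

(** The superlevel set is covered by level sets in cells, each of measure at most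
    [B * (v i ^ p * s i) ^ (q / p)]. The embedding with [r = q / p] sums these bounds, and a [q]-th
    root removes [lambda]. *)
Lemma positive_weak_type : exists2 C : R, (0 <= C)%R &
  forall f : Rn R n -> R, weighted_Lp p w f ->
    weak_Lnorm q (fun x => (w x)%:E * fractional_maximal alpha f x)
      <= C%:E * weighted_Lnorm p w f.
Proof.
have p0 : (0 < p)%R by have := p1; lra.
have [Wf sWE] := choice icell_mass.
have [s sE] := choice sWE.
have K0 : (0 <= K)%R.
  have [_ _ _ _] := sE ([ffun=> false], (0%:Z, [tuple 0%:Z | _ < n])).
  by apply: le_trans; rewrite mulr_ge0 ?powR_ge0.
have s0 i : (0 < s i)%R by case: (sE i).
have sgE i : \int[mu]_(x in icell i) (sg x)%:E = (s i)%:E by case: (sE i).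
have [c /andP[c0 c1] ac] := Apq_absolutely_continuous p1 q0 mw w0 wK.
have rho01 : (0 < 1 - c < 1)%R by apply/andP; split; lra.
have [C0 C00 emb] := @laminar_embedding _ _ _ mu index p (q / p) (1 - c)
  p1 (q_div_p_gt1 alpha_n p_lt pq) rho01.
pose N := (#|{ffun 'I_n -> bool}|%:R : R)%R.
have NC0 : (0 <= N * C0)%R by rewrite mulr_ge0.
pose c12 := ((12 : R) `^ (n%:R - alpha))%R.
have c120 : (0 < c12)%R by rewrite powR_gt0.
exists (K * c12 * (N * C0) `^ q^-1)%R.
  by rewrite !mulr_ge0 ?powR_ge0// ltW.
move=> f [mf]; rewrite /weighted_Lnorm.
set I := \int[mu]_x _ => Ioo.
pose phi x := (`|f x| `^ p * w x `^ p)%R.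
have mabs := measurable_fun_norm mf.
have mphi : measurable_fun setT phi by exact: measurable_fun_norm_powRM.
(* Since [(- p') (1 - p) = p], the weight [w ^ p] is [sg ^ (1 - p)]. *)
have phiE x : phi x = (`|f x| `^ p * sg x `^ (1 - p))%R.
  rewrite /phi -powRrM; congr (_ * _ `^ _)%R.
  by rewrite /conjugate_exponent; field; rewrite gt_eqF//; have := p1; lra.
have phi0 x : (0 <= phi x)%R by rewrite mulr_ge0 ?powR_ge0.
have I0 : 0 <= I by apply: integral_ge0 => x _; rewrite lee_fin phi0.
have Ifin : I \is a fin_num.
  rewrite ge0_fin_numE//; apply: lty_poweRy Ioo.
  by rewrite gt_eqF// invr_gt0.
set Phi := fine I.
have PhiE : \int[mu]_x (phi x)%:E = Phi%:E by rewrite fineK.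
have Phi0 : (0 <= Phi)%R by rewrite fine_ge0.
pose a i := fine (\int[mu]_(x in icell i) `|f x|%:E).
have aE i : \int[mu]_(x in icell i) `|f x|%:E = (a i)%:E.
  by rewrite fineK//; exact: (icell_average mf mphi phiE PhiE (sgE i)).
have a0 i : (0 <= a i)%R.
  by rewrite -lee_fin -aE; apply: integral_ge0 => x _; rewrite lee_fin.
pose v i := (a i / s i)%R.
have v0 i : (0 <= v i)%R by rewrite divr_ge0// ltW.
have vs i : (v i * s i = a i)%R by rewrite divfK// gt_eqF.
apply: ge_ereal_sup => _ [lambda /= l0 <-].
set E := [set x | _].
pose B := ((K * c12 / lambda) `^ q)%R.
have B0 : (0 <= B)%R by exact: powR_ge0.
have muE : mu E <= (B * (N * C0 * Phi `^ (q / p)))%:E.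
  apply: le_trans (le_lebesgue_Rn (level_cover mf l0 aE)) _.
  apply: lebesgue_Rn_countable_le => J uJ.
  have lev i : mu (icell i `&` [set x | lambda < w x *
      (12 `^ (n%:R - alpha) * (scale i `^ (alpha - n%:R) * a i))]%R) <=
      (B * (v i `^ p * s i) `^ (q / p))%:E.
    rewrite -/c12; set A := (scale i `^ _ * a i)%R.
    have A0 : (0 <= A)%R by rewrite mulr_ge0 ?powR_ge0.
    (* The level [lambda / (c12 * A)] used below needs [A > 0]; for [A = 0] the set is empty. *)
    have [A00|Apos] := eqVneq A 0%R.
      rewrite A00 mulr0 (_ : _ `&` _ = set0) ?measure0 ?lee_fin ?mulr_ge0 ?powR_ge0//.
      by apply/seteqP; split=> x // -[_ /=]; rewrite mulr0 ltNge (ltW l0).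
    have {}Apos : (0 < A)%R by rewrite lt_neqAle eq_sym Apos.
    have [_ W0 _ W_lev WK] := sE i.
    have cA : (0 < c12 * A)%R by rewrite mulr_gt0.
    apply: le_trans (_ : (Wf i / (lambda / (c12 * A)) `^ q)%:E <= _).
      apply: le_trans (W_lev _ (divr_gt0 l0 cA)); apply: le_lebesgue_Rn.
      by move=> x [ix /= lx]; split=> //=; rewrite ltr_pdivrMr.
    rewrite lee_fin.
    have -> : (Wf i / (lambda / (c12 * A)) `^ q =
        (c12 / lambda) `^ q * (Wf i * A `^ q))%R.
      have cl0 : (0 < c12 / lambda)%R by rewrite divr_gt0.
      have -> : (lambda / (c12 * A) = (c12 / lambda * A)^-1)%R.
        by field; rewrite !gt_eqF.
      have clA0 : (0 <= c12 / lambda * A)%R by rewrite ltW// mulr_gt0.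
      rewrite -(powR_inv1 clA0) powRAC powR_inv1 ?powR_ge0// invrK.
      by rewrite powRM ?(ltW cl0) ?(ltW A0)//; ring.
    have -> : B = ((c12 / lambda) `^ q * K `^ q)%R.
      have cl0 : (0 <= c12 / lambda)%R by rewrite ltW// divr_gt0.
      by rewrite /B -powRM//; congr (_ `^ _)%R; ring.
    rewrite -mulrA ler_wpM2l ?powR_ge0// /A -(vs i).
    exact: (level_exponent alpha_n p_lt pq (scale_gt0 i)).
  apply: le_trans (_ : (\sum_(i <- J) B * (v i `^ p * s i) `^ (q / p))%:E <= _).
    by rewrite -sumEFin; apply: lee_sum => i _; exact: lev.
  rewrite lee_fin -mulr_sumr ler_wpM2l//.
  (* Cells with different shifts need not be nested or disjoint, so the embedding is applied in each
     grid separately; the number [N] of grids enters the constant. *)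
  rewrite (partition_big (fun i : index => i.1) xpredT)//=.
  apply: le_trans (_ : (\sum_(t : {ffun 'I_n -> bool}) C0 * Phi `^ (q / p))%R <= _)%R.
    apply: ler_sum => t _; rewrite -big_filter.
    apply: (emb [seq i <- J | i.1 == t] icell s v (fun x => `|f x|)%R sg phi Phi).
    - exact: filter_uniq.
    - move=> i j; rewrite !mem_filter => /andP[/eqP it _] /andP[/eqP jt _].
      by rewrite /icell it jt; exact: cell_laminar.
    - exact: measurable_icell.
    - exact: s0.
    - exact: v0.
    - move=> i j; rewrite !mem_filter => /andP[/eqP it _] /andP[/eqP jt _].
      move=> ij sub; apply: (icell_decay ac (ltW c0) sgE _ ij sub).
      by rewrite it jt.
    - exact: mabs.
    - by [].
    - exact: measurable_sg.
    - by move=> x; exact: powR_gt0.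
    - exact: mphi.
    - exact: phiE.
    - exact: sgE.
    - by move=> i; rewrite aE vs.
    - exact: PhiE.
  by rewrite sumr_const -mulr_natl mulrA.
apply: le_trans (_ : lambda%:E * (B * (N * C0 * Phi `^ (q / p)))%:E `^ q^-1 <= _).
  apply: lee_wpmul2l; first by rewrite lee_fin ltW.
  by apply: gt0_ler_poweR => //; rewrite ?invr_ge0 ?(ltW q0)// in_itv/= leey
    ?measure_ge0 ?lee_fin ?mulr_ge0 ?powR_ge0.
rewrite poweR_EFin -(fineK Ifin) poweR_EFin -!EFinM lee_fin -/Phi.
rewrite powRM ?mulr_ge0 ?powR_ge0// powRM ?powR_ge0//.
have -> : (B `^ q^-1 = K * c12 / lambda)%R.
  rewrite -powRrM mulfV ?gt_eqF// powRr1// divr_ge0 ?mulr_ge0// ltW//.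
have -> : ((Phi `^ (q / p)) `^ q^-1 = Phi `^ p^-1)%R.
  by rewrite -powRrM; congr (_ `^ _)%R; field; rewrite !gt_eqF.
rewrite le_eqVlt; apply/orP; left; apply/eqP; field.
by rewrite gt_eqF.
Qed.

End sufficiency.

(** * Necessity *)

Section exponents_necessity.
Local Open Scope ring_scope.
Context {R : realType} (n : nat) (alpha p q : R).
Hypothesis alpha_n : 0 < alpha < n%:R.
Hypothesis p_lt : 1 < p < n%:R / alpha.
Hypothesis pq : p^-1 - q^-1 = alpha / n%:R.

(** Solves the testing inequality for the product in the weight condition. [I ^ (1/p)] bounds the
    norm of the test function, and the denominator is its fractional average on a cube of measure
    [V]; the powers of [V] match because [alpha / n = 1/p - 1/q]. *)
Lemma test_exponent (C I V W : R) : 0 <= C -> 0 < I -> 0 < V -> 0 <= W ->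
  W <= (C * I `^ p^-1 / (V `^ (alpha / n%:R) * (V^-1 * I))) `^ q ->
  (V^-1 * W) `^ q^-1 * (V^-1 * I) `^ (conjugate_exponent p)^-1 <= C.
Proof.
move=> C0 I0 V0 W0 H; have q0 := q_gt0 alpha_n p_lt pq.
rewrite (conjugate_inv p_lt) -pq in H *.
have V'0 : 0 <= V^-1 by rewrite invr_ge0 ltW.
have Va := powR_gt0 (p^-1 - q^-1) V0.
have D0 : 0 < V `^ (p^-1 - q^-1) * (V^-1 * I) by rewrite !mulr_gt0// invr_gt0.
have Wq : W `^ q^-1 <= C * I `^ p^-1 / (V `^ (p^-1 - q^-1) * (V^-1 * I)).
  set X := _ / _ in H *.
  have X0 : 0 <= X by apply: divr_ge0; [rewrite mulr_ge0 ?powR_ge0|exact: ltW].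
  have -> : X = (X `^ q) `^ q^-1 by rewrite -powRrM mulfV ?gt_eqF// powRr1.
  by apply: ler_powR_base; rewrite ?invr_ge0// ltW.
rewrite powRM//; rewrite ler_pdivlMr// in Wq.
have VI0 : 0 < V^-1 * I by rewrite mulr_gt0// invr_gt0.
have E1 : (V^-1 * I) `^ (1 - p^-1) = V^-1 * I / ((V^-1) `^ p^-1 * I `^ p^-1).
  rewrite powRB; last by rewrite (gt_eqF VI0) implybT.
  by rewrite powRr1 ?(ltW VI0)// powRM ?(ltW I0).
have E2 : V `^ (p^-1 - q^-1) = (V^-1) `^ q^-1 / (V^-1) `^ p^-1.
  have inv r : V `^ r = ((V^-1) `^ r)^-1.
    by rewrite -(powR_inv1 (ltW V0)) powRAC powR_inv1 ?powR_ge0// invrK.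
  rewrite powRB; last by rewrite (gt_eqF V0) implybT.
  by rewrite !inv invrK mulrC.
rewrite E1; rewrite E2 in Wq.
have Ip : 0 < I `^ p^-1 by rewrite powR_gt0.
have Vp : 0 < (V^-1) `^ p^-1 by rewrite powR_gt0// invr_gt0.
rewrite (_ : _ * _ =
  W `^ q^-1 * ((V^-1) `^ q^-1 / (V^-1) `^ p^-1 * (V^-1 * I)) / I `^ p^-1).
  by rewrite ler_pdivrMr.
by field; rewrite !gt_eqF.
Qed.

End exponents_necessity.

(** * Comparison up to null sets *)

Section modulo_null_sets.
Context {R : realType} {n : nat}.
Local Notation mu := (@lebesgue_Rn R n).

Lemma le_lebesgue_Rn_null (A B N : set (Rn R n)) : mu N = 0 ->
  A `<=` B `|` N -> mu A <= mu B.
Proof.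
move=> N0 /le_lebesgue_Rn/le_trans; apply.
apply: le_trans (outer_measureU2 (borel_lebesgue R n)^*%mu _ _) _.
by rewrite [X in _ + X <= _]N0 adde0.
Qed.

Lemma ae_null_setP (P : set (Rn R n)) : {ae mu, forall x, P x} ->
  exists2 N, mu N = 0 & forall x, ~ N x -> P x.
Proof.
by move=> [N [_ N0 PN]]; exists N => // x Nx; apply: contrapT => Px; apply/Nx/PN.
Qed.

Lemma weak_Lnorm_ae_le (r : R) (g h : Rn R n -> \bar R) (N : set (Rn R n)) :
  (0 < r)%R -> mu N = 0 -> (forall x, ~ N x -> g x = h x) ->
  weak_Lnorm r g <= weak_Lnorm r h.
Proof.
move=> r0 N0 gh; apply: ge_ereal_sup => _ [lambda /= l0 <-].
apply: le_trans (weak_Lnorm_ge r h l0); apply: lee_wpmul2l.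
  by rewrite lee_fin ltW.
apply: gt0_ler_poweR; rewrite ?invr_ge0 ?(ltW r0) ?in_itv/= ?leey ?measure_ge0//.
apply: (le_lebesgue_Rn_null N0) => x /= lx.
by have [Nx|Nx] := pselect (N x); [right|left; rewrite -gh].
Qed.

End modulo_null_sets.

Section necessity.
Context {R : realType} {n : nat} (alpha p q C : R) (w : Rn R n -> R).
Local Notation mu := (@lebesgue_Rn R n).
Local Notation p' := (conjugate_exponent p).
Hypothesis alpha_n : (0 < alpha < n%:R)%R.
Hypothesis p_lt : (1 < p < n%:R / alpha)%R.
Hypothesis pq : (p^-1 - q^-1 = alpha / n%:R)%R.
Hypothesis hw : weight w.
Hypothesis weak_type : forall f : Rn R n -> R, weighted_Lp p w f ->
  weak_Lnorm q (fun x => (w x)%:E * fractional_maximal alpha f x)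
    <= C%:E * weighted_Lnorm p w f.

Let p1 : (1 < p)%R. Proof. by case/andP: p_lt. Qed.
Let q0 : (0 < q)%R := q_gt0 alpha_n p_lt pq.

(* The extremal function [w `^ (- p')], regularized where [w] is small. *)
Definition regularized (e : R) (x : Rn R n) : R :=
  (Num.max (w x) e `^ (- p'))%R.

Lemma regularized_gt0 e x : (0 < e)%R -> (0 < regularized e x)%R.
Proof. by move=> e0; rewrite powR_gt0// lt_max e0 orbT. Qed.

Lemma measurable_regularized e : measurable_fun setT (regularized e).
Proof. by case: hw => mw _; exact: measurable_fun_max_powR. Qed.

Lemma regularized_le e x : (0 < e)%R -> (regularized e x <= e `^ (- p'))%R.
Proof.
move=> e0; rewrite /regularized !powRN lef_pV2 ?posrE ?powR_gt0//; last first.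
  by rewrite lt_max e0 orbT.
apply: ler_powR_base; [exact/ltW/conjugate_gt0|exact: ltW|].
by rewrite le_max lexx orbT.
Qed.

(** Enlarge [w] to [max(w, e)] and use [p - p p' = - p']. The [p]-th power of the norm of the test
    function is thus at most its integral. *)
Lemma regularized_powR e x : (0 < e)%R -> (0 <= w x)%R ->
  (regularized e x `^ p * w x `^ p <= regularized e x)%R.
Proof.
move=> e0 wx0; have p0 : (0 < p)%R by have := p1; lra.
have m0 : (0 < Num.max (w x) e)%R by rewrite lt_max e0 orbT.
apply: (@le_trans _ _ (regularized e x `^ p * Num.max (w x) e `^ p)%R).
  rewrite ler_wpM2l ?powR_ge0//; apply: ler_powR_base => //; first exact: ltW.
  by rewrite le_max lexx.
rewrite /regularized -powRrM -powRD; last by rewrite (gt_eqF m0) implybT.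
rewrite (_ : (- p' * p + p = - p')%R)//.
by rewrite /conjugate_exponent; field; rewrite gt_eqF//; have := p1; lra.
Qed.

(** Weak type is tested on [regularized e] cut off to the cube. Its norm is at most [I ^ (1/p)],
    while its maximal function is at least [m] on the cube, so a level set of [w] there lies in a
    level set of [w] times the maximal function. [C] may be negative, hence the absolute value. *)
Lemma test_cube (a : n.-tuple R) (l e : R) : (0 < l)%R -> (0 < e)%R ->
  exists2 I : R, (0 < I)%R /\
    \int[mu]_(x in cube a l) (regularized e x)%:E = I%:E &
  weak_Lnorm 1 (fun x => (w x `^ q * \1_(cube a l) x)%:E) <=
    ((`|C| * I `^ p^-1 /
     ((l ^+ n) `^ (alpha / n%:R) * ((l ^+ n)^-1 * I))) `^ q)%:E.
Proof.
move=> l0 e0; pose Q := cube a l.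
have p0 : (0 < p)%R by have := p1; lra.
have [mw wge0] := hw; have [N N0 wN] := ae_null_setP wge0.
have V0 : (0 < l ^+ n)%R by rewrite exprn_gt0.
have muQ : mu Q = (l ^+ n)%:E by exact: lebesgue_Rn_cube.
have mQ : measurable Q by exact: measurable_cube.
have mr := measurable_regularized e.
have mre : measurable_fun setT (fun x => (regularized e x)%:E).
  exact/measurable_EFinP.
have r0 x := regularized_gt0 x e0.
have I0 : 0 < \int[mu]_(x in Q) (regularized e x)%:E.
  apply: integral_gt0; [exact: mQ|exact: mr|exact: r0|].
  by rewrite muQ lte_fin.
have Ioo : \int[mu]_(x in Q) (regularized e x)%:E < +oo.
  apply: (@le_lt_trans _ _ (\int[mu]_(x in Q) (cst (e `^ (- p'))%:E x))).
    apply: ge0_le_integral.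
    - exact: mQ.
    - by move=> x _; rewrite lee_fin ltW.
    - exact: measurable_funS mre.
    - exact: measurable_cst.
    - by move=> x _; rewrite lee_fin regularized_le.
  have -> := integral_cst mu mQ (e `^ (- p'))%:E.
  by move: muQ => /= ->; rewrite -EFinM ltry.
set I := fine (\int[mu]_(x in Q) (regularized e x)%:E).
have IE : \int[mu]_(x in Q) (regularized e x)%:E = I%:E.
  by rewrite fineK// ge0_fin_numE// ltW.
have {}I0 : (0 < I)%R by rewrite -lte_fin -IE.
exists I => //.
pose f x := (regularized e x * \1_Q x)%R.
have f0 x : (0 <= f x)%R by rewrite mulr_ge0// ltW.
have mf : measurable_fun setT f by exact: measurable_fun_indicM.
set b := (`|C| * I `^ p^-1)%R.
set m := ((l ^+ n) `^ (alpha / n%:R) * ((l ^+ n)^-1 * I))%R.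
have b0 : (0 <= b)%R by rewrite mulr_ge0 ?powR_ge0.
have m0 : (0 < m)%R by rewrite mulr_gt0 ?powR_gt0// mulr_gt0// invr_gt0.
have mphi := measurable_fun_norm_powRM p mf mw.
have norm_le : \int[mu]_x ((`|f x| `^ p * w x `^ p)%R)%:E <= I%:E.
  rewrite -IE [leRHS]integral_mkcond; apply: ae_ge0_le_integral.
  - exact: measurableT.
  - by move=> x _; rewrite lee_fin mulr_ge0 ?powR_ge0.
  - exact/measurable_EFinP.
  - by move=> x _; rewrite epatch_indic mule_ge0// lee_fin// ltW.
  - by apply/(measurable_restrictT _ mQ).1; exact: measurable_EFin_restrict mr.
  move: wge0; apply: filterS => x wx0 _.
  rewrite epatch_indic -EFinM lee_fin ger0_norm// /f indicE.
  have [xQ|xQ] := boolP (x \in Q).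
    by rewrite !mulr1; exact: regularized_powR.
  by rewrite !mulr0 powR0 ?mul0r// gt_eqF.
have int0 : 0 <= \int[mu]_x ((`|f x| `^ p * w x `^ p)%R)%:E.
  by apply: integral_ge0 => x _; rewrite lee_fin mulr_ge0 ?powR_ge0.
have norm_le' : weighted_Lnorm p w f <= (I `^ p^-1)%:E.
  rewrite -poweR_EFin; apply: gt0_ler_poweR => //.
  - by rewrite invr_ge0 ltW.
  - by rewrite in_itv/= leey int0.
  - by rewrite in_itv/= leey lee_fin ltW.
have weak_le : weak_Lnorm q (fun x => (w x)%:E * fractional_maximal alpha f x)
    <= b%:E.
  apply: le_trans (weak_type _) _.
    by split => //; apply: le_lt_trans norm_le' _; exact: ltry.
  rewrite EFinM; apply: le_trans (_ : `|C|%:E * weighted_Lnorm p w f <= _).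
    by apply: lee_wpmul2r; [exact: poweR_ge0|rewrite lee_fin ler_norm].
  by apply: lee_wpmul2l.
have maxQ x : Q x -> m%:E <= fractional_maximal alpha f x.
  move=> Qx; apply: ereal_sup_ubound; exists Q; first by exists a, l.
  rewrite muQ poweR_EFin inver gt_eqF// indicE mem_set// mule1 -/Q.
  rewrite (_ : \int[mu]_(y in Q) `|f y|%:E = I%:E) -?EFinM//.
  rewrite -IE; apply: eq_integral => y yQ.
  by rewrite ger0_norm// /f indicE yQ mulr1.
apply: ge_ereal_sup => _ [lambda /= l0' <-].
set A := [set x | _]; rewrite invr1 poweRe1 ?measure_ge0//.
(* Level [lambda] for [w ^ q] is level [lambda ^ (1/q)] for [w], and yields level
   [lambda ^ (1/q) * m] for [w] times the maximal function. *)
have lq0 : (0 < lambda `^ q^-1)%R by rewrite powR_gt0.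
have u0 : (0 < lambda `^ q^-1 * m)%R by rewrite mulr_gt0.
have AE : A `<=` [set x | (lambda `^ q^-1 * m)%:E <
    `|(w x)%:E * fractional_maximal alpha f x| ] `|` N.
  (* Off [N] the weight is nonnegative, as the passage from [w ^ q > lambda] to [w > lambda ^ (1/q)]
     requires. *)
  move=> x /= lx; have [Nx|Nx] := pselect (N x); [by right|left => /=].
  have wx0 := wN x Nx.
  move: lx; rewrite /A /= indicE -/Q; have [xQ|_] := boolP (x \in Q); last first.
    by rewrite mulr0 normr0 lte_fin ltNge (ltW l0').
  rewrite mulr1 lte_fin ger0_norm ?powR_ge0// => lx.
  have Mx := maxQ x (set_mem xQ).
  have wl : (lambda `^ q^-1 < w x)%R.
    rewrite -[ltRHS](@powRr1 R)// -(mulfV (_ : q != 0)%R) ?gt_eqF// powRrM.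
    by apply: gt0_ltr_powR; rewrite ?invr_gt0// nnegrE ?powR_ge0// ltW.
  rewrite gee0_abs; last first.
    by rewrite mule_ge0// ?lee_fin//; apply: le_trans Mx; rewrite lee_fin ltW.
  apply: (@lt_le_trans _ _ ((w x)%:E * m%:E)).
    by rewrite -EFinM lte_fin ltr_pM2r.
  by apply: lee_wpmul2l; rewrite ?lee_fin.
have := weak_Lnorm_ge q (fun x => (w x)%:E * fractional_maximal alpha f x) u0.
set Aw := [set x | _] in AE *.
move=> /le_trans/(_ weak_le).
rewrite -lee_pdivlMl// -EFinM => h.
have hA : mu A <= ((b / m / lambda `^ q^-1) `^ q)%:E.
  apply: le_trans (le_lebesgue_Rn_null N0 AE) _.
  rewrite -[leLHS]poweRe1 ?measure_ge0// -(mulVf (_ : q != 0)%R) ?gt_eqF//.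
  rewrite poweRrM -poweR_EFin; apply: gt0_ler_poweR; first exact: ltW.
  - by rewrite in_itv/= leey poweR_ge0.
  - by rewrite in_itv/= leey lee_fin !divr_ge0// ltW.
  apply: le_trans h _.
  rewrite (_ : ((lambda `^ q^-1 * m)^-1 * b = b / m / lambda `^ q^-1)%R)//.
  by field; rewrite !gt_eqF.
apply: le_trans (_ : lambda%:E * ((b / m / lambda `^ q^-1) `^ q)%:E <= _).
  by apply: lee_wpmul2l => //; rewrite lee_fin ltW.
rewrite -EFinM lee_fin powRM ?invr_ge0 ?(ltW lq0)//; last by rewrite divr_ge0// ltW.
rewrite -(powR_inv1 (ltW lq0)) -!powRrM.
rewrite (_ : (q^-1 * (-1 * q) = -1)%R); last by field; rewrite gt_eqF.
by rewrite powR_inv1 ?(ltW l0')// mulrCA divff ?mulr1// gt_eqF.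
Qed.


Lemma regularized_nondecreasing x :
  nondecreasing_seq (fun k : nat => (regularized k.+1%:R^-1 x)%:E).
Proof.
move=> k m km; rewrite lee_fin /regularized !powRN.
have e0 j : (0 < Num.max (w x) j.+1%:R^-1)%R by rewrite lt_max invr_gt0 ltr0Sn orbT.
rewrite lef_pV2 ?posrE ?powR_gt0//; apply: ler_powR_base.
- exact/ltW/conjugate_gt0.
- exact: ltW.
rewrite ge_max !le_max lexx/=; apply/orP; right.
by rewrite lef_pV2 ?posrE// ler_nat.
Qed.

(** Where [w > 0] the sequence reaches [w ^ (- p')] once [1 / (k + 1) < w]. Where [w = 0] it is
    [(k + 1) ^ p'], at least [k + 1] because [p' >= 1], and so tends to [+oo], the value of the
    inverse of 0. *)
Lemma regularized_lim x : (0 <= w x)%R ->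
  ((w x `^ p')%R%:E)^-1 <= limn (fun k : nat => (regularized k.+1%:R^-1 x)%:E).
Proof.
have p'0 : (0 < p')%R by exact: conjugate_gt0.
have p'1 : (1 <= p')%R.
  rewrite /conjugate_exponent ler_pdivlMr; first by have := p1; lra.
  by have := p1; lra.
have /ereal_nondecreasing_cvgn/cvg_lim := @regularized_nondecreasing x.
move=> -> //; rewrite le_eqVlt => /predU1P[wx|wx0].
  rewrite -wx powR0 ?gt_eqF// inve0 leye_eq; apply/eqP/eqyP => A _.
  have := archi_boundP (normr_ge0 A); set k := Num.bound _ => Ak.
  apply: (@le_trans _ _ (regularized k.+1%:R^-1 x)%:E); last first.
    by apply: ereal_sup_ubound; exists k.
  rewrite lee_fin /regularized -wx max_r ?invr_ge0// powRN.
  rewrite -(powR_inv1 (ler0n R _)) powRAC powR_inv1 ?powR_ge0// invrK.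
  apply: le_trans (le1r_powR _ p'1); last by rewrite ler1n.
  by rewrite (le_trans (ler_norm _))// (le_trans (ltW Ak))// ler_nat.
have [k] := ltr_add_invr wx0; rewrite add0r => kw.
apply: (@le_trans _ _ (regularized k.+1%:R^-1 x)%:E); last first.
  by apply: ereal_sup_ubound; exists k.
rewrite inver gt_eqF ?powR_gt0// lee_fin /regularized powRN max_l// ltW//.
Qed.

(** Monotone convergence along [e = 1 / (k + 1)] transfers a bound uniform in [e] to the dual weight
    itself. *)
Lemma dual_integral_le (Q : set (Rn R n)) (G : \bar R) : measurable Q ->
  (forall e : R, (0 < e)%R -> \int[mu]_(x in Q) (regularized e x)%:E <= G) ->
  \int[mu]_(x in Q) ((w x `^ p')%R%:E)^-1 <= G.
Proof.
move=> mQ IG; have [mw wge0] := hw.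
have mr k : measurable_fun Q (fun x => (regularized k.+1%:R^-1 x)%:E).
  exact/measurable_EFin_restrict/measurable_regularized.
have r0 k x : Q x -> 0 <= (regularized k.+1%:R^-1 x)%:E.
  by move=> _; rewrite lee_fin powR_ge0.
have nd x : Q x -> nondecreasing_seq (fun k : nat => (regularized k.+1%:R^-1 x)%:E).
  by move=> _; exact: regularized_nondecreasing.
have E := @monotone_convergence _ _ _ mu Q mQ
  (fun k x => (regularized k.+1%:R^-1 x)%:E) mr r0 nd.
apply: (@le_trans _ _
    (limn (fun k => \int[mu]_(x in Q) (regularized k.+1%:R^-1 x)%:E))).
  rewrite -E; apply: ae_ge0_le_integral.
  - exact: mQ.
  - by move=> x _; rewrite inve_ge0 lee_fin powR_ge0.
  - exact: measurable_funS (measurable_inv_powR _ mw).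
  - move=> x Qx; apply: lime_ge.
      exact/ereal_nondecreasing_is_cvgn/regularized_nondecreasing.
    by apply: nearW => k; exact: r0.
  - apply: (emeasurable_fun_cvg _ _ mr) => x Qx.
    exact/ereal_nondecreasing_is_cvgn/regularized_nondecreasing.
  move: wge0; apply: filterS => x wx0 _; exact: regularized_lim.
apply: lime_le.
  apply: ereal_nondecreasing_is_cvgn => k m km; apply: ge0_le_integral.
  - exact: mQ.
  - exact: r0.
  - exact: mr.
  - exact: mr.
  - by move=> x _; exact: regularized_nondecreasing.
by apply: nearW => k; apply: IG; rewrite invr_gt0.
Qed.

Lemma Apq_star_of_weak_type : Apq_star p q w.
Proof.
suff : Apq_star_const p q w <= `|C|%:E by move/le_lt_trans; apply; exact: ltry.
have p'0 : (0 < p')%R by exact: conjugate_gt0.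
apply: ge_ereal_sup => _ [_ [a [l [l0 ->]]] <-].
have V0 : (0 < l ^+ n)%R by rewrite exprn_gt0.
set V := (l ^+ n)%R in V0.
have muQ : mu (cube a l) = V%:E by exact: lebesgue_Rn_cube.
set W := weak_Lnorm _ _; set S := \int[_]_(x in _) _.
have W0 : 0 <= W by exact: weak_Lnorm_ge0.
(* A single test, with [e = 1], shows that [W] is finite. *)
have [I0 _ WI0] := test_cube a l0 ltr01.
have Wfin : W \is a fin_num by rewrite ge0_fin_numE// (le_lt_trans WI0)// ltry.
have iV0 : (0 <= V^-1)%R by rewrite invr_ge0 ltW.
rewrite muQ inver gt_eqF//.
(* If [W = 0], the product vanishes even when [S = +oo], by the convention for zero times
   infinity. *)
have [Wz|Wn0] := eqVneq W 0.
  by rewrite Wz mule0 poweR0r ?mul0e ?lee_fin// gt_eqF ?invr_gt0.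
have Wpos : (0 < fine W)%R by rewrite fine_gt0// lt_neqAle eq_sym Wn0 W0 ltey_eq Wfin.
set D := ((V^-1 * fine W) `^ q^-1)%R.
have D0 : (0 < D)%R by rewrite powR_gt0// mulr_gt0// invr_gt0.
(* For [W > 0] the tested inequality can be solved for the integral of [regularized e]. The
   resulting bound does not involve [e], so it passes to [S]. *)
have SG : S <= (V * (`|C| / D) `^ p')%R%:E.
  apply: dual_integral_le; first exact: measurable_cube.
  move=> e e0; have [I [I0' IE] WI] := test_cube a l0 e0.
  rewrite IE lee_fin; rewrite -/W -(fineK Wfin) lee_fin in WI.
  have := test_exponent alpha_n p_lt pq (normr_ge0 C) I0' V0 (ltW Wpos) WI.
  rewrite -/D mulrC -ler_pdivlMr// => H.
  rewrite -ler_pdivrMl//.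
  rewrite -[leLHS](@powRr1 R) ?mulr_ge0 ?(ltW I0')//.
  rewrite -(mulVf (_ : p' != 0)%R) ?gt_eqF// powRrM; apply: ler_powR_base => //.
    exact: ltW.
  exact: powR_ge0.
have S0 : 0 <= S by apply: integral_ge0 => x _; rewrite inve_ge0 lee_fin powR_ge0.
have Sfin : S \is a fin_num by rewrite ge0_fin_numE// (le_lt_trans SG)// ltry.
rewrite -(fineK Wfin) -(fineK Sfin) -!EFinM lee_fin -/D.
rewrite -ler_pdivlMl// [leRHS]mulrC.
rewrite -(fineK Sfin) lee_fin in SG.
apply: (@le_trans _ _ ((V^-1 * (V * (`|C| / D) `^ p')) `^ p'^-1)%R).
  apply: ler_powR_base; first by rewrite invr_ge0 ltW.
    by rewrite mulr_ge0// fine_ge0.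
  by rewrite ler_wpM2l.
rewrite mulKf ?gt_eqF// -powRrM mulfV ?gt_eqF// powRr1//.
by rewrite divr_ge0// ltW.
Qed.

End necessity.

(** * Weights modulo null sets *)

Section almost_everywhere.
Context {R : realType} {n : nat} (p q : R).
Local Notation mu := (@lebesgue_Rn R n).
Local Notation p' := (conjugate_exponent p).
Implicit Types (v w : Rn R n -> R).
Hypothesis p1 : (1 < p)%R.
Hypothesis q0 : (0 < q)%R.

Lemma eq_off_ae (N : set (Rn R n)) (P : set (Rn R n)) : measurable N ->
  mu N = 0 -> (forall x, ~ N x -> P x) -> {ae mu, forall x, P x}.
Proof.
by move=> mN N0 NP; exists N; split => // x /= Px; apply: contrapT => /NP.
Qed.

(** Allows the weight to be replaced by an everywhere positive one. *)
Lemma Apq_star_const_ae v w (N : set (Rn R n)) : measurable N -> mu N = 0 ->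
  measurable_fun setT v -> measurable_fun setT w ->
  (forall x, ~ N x -> v x = w x) -> Apq_star_const p q v = Apq_star_const p q w.
Proof.
move=> mN N0 mv mw vw; rewrite /Apq_star_const /=.
apply: (congr1 (@ereal_sup R)); apply: eq_imagel => _ [a [l [l0 ->]]].
have -> : weak_Lnorm 1 (fun x => (v x `^ q * \1_(cube a l) x)%:E) =
    weak_Lnorm 1 (fun x => (w x `^ q * \1_(cube a l) x)%:E).
  apply/eqP; rewrite eq_le; apply/andP; split;
    by apply: (weak_Lnorm_ae_le ltr01 N0) => x /vw ->.
suff -> : \int[mu]_(x in cube a l) ((v x `^ p')%R%:E)^-1 =
    \int[mu]_(x in cube a l) ((w x `^ p')%R%:E)^-1 by [].
apply: ae_eq_integral.
- exact: measurable_cube.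
- exact: measurable_funS (measurable_inv_powR _ mv).
- exact: measurable_funS (measurable_inv_powR _ mw).
by apply: (eq_off_ae mN N0) => x /vw -> .
Qed.

(** An increasing exhaustion of the space by cubes, through which nullity is checked locally. *)
Definition centered (k : nat) : set (Rn R n) :=
  cube [tuple (- k.+1%:R)%R | _ < n] (k.+1%:R + k.+1%:R).

Lemma centeredP k (x : n.-tuple R) :
  centered k x <-> forall i, (`|tnth x i| <= k.+1%:R)%R.
Proof.
by split=> H i; have := H i; rewrite ?tnth_mktuple addKr ler_norml.
Qed.

Lemma centered_sub k m : (k <= m)%N -> centered k `<=` centered m.
Proof.
move=> km x /centeredP xk; apply/centeredP => i.
by rewrite (le_trans (xk i))// ler_nat.
Qed.

Lemma centered_cover : \bigcup_k centered k = setT.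
Proof.
apply/seteqP; split=> // x _; pose s := (\sum_i `|tnth (x : n.-tuple R) i|)%R.
have := archi_boundP (sumr_ge0 _ (fun i _ => normr_ge0 _) : 0 <= s)%R.
set k := Num.bound _ => sk; exists k => //; apply/centeredP => i.
apply: (@le_trans _ _ s).
  by rewrite /s (bigD1 i)//= lerDl sumr_ge0.
by rewrite (le_trans (ltW sk))// ler_nat.
Qed.

Lemma null_of_centered (A : set (Rn R n)) :
  (forall k, mu (centered k `&` A) = 0) -> mu A = 0.
Proof.
move=> A0; apply/eqP; rewrite eq_le measure_ge0 andbT.
apply: (@le_trans _ _ (mu (\bigcup_k (centered k `&` A)))).
  apply: le_lebesgue_Rn => x Ax.
  have [k _ xk] : (\bigcup_k centered k) x by rewrite centered_cover.
  by exists k.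
by apply: lebesgue_Rn_countable_le => J _; rewrite big1// => k _; exact: A0.
Qed.

(* If [w] vanishes on a non-null set, its dual weight has infinite mass on all
   large cubes, and the convention [0 * +oo = 0] only allows [w = 0]. *)
Lemma Apq_star_zero_or_positive w : weight w -> Apq_star p q w ->
  mu [set x | w x <= 0]%R = 0 \/ mu [set x | 0 < w x]%R = 0.
Proof.
move=> [mw wge0] wA; have [N N0 wN] := ae_null_setP wge0.
have p'0 : (0 < p')%R by exact: conjugate_gt0.
have [|Z0] := pselect (mu [set x | w x <= 0]%R = 0); [by left|right].
have [k Zk] : exists k, mu (centered k `&` [set x | w x <= 0]%R) <> 0.
  by apply: contrapT => H; apply/Z0/null_of_centered => k; apply: contrapT => Hk;
    apply: H; exists k.
(* The cube of index [m] contains both the one where [w] vanishes on a non-null set and the one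
   where [w] has to be shown null. *)
apply: null_of_centered => j; pose m := maxn k j.
have l0 : (0 < m.+1%:R + m.+1%:R :> R)%R by rewrite addr_gt0.
have mQ : measurable (centered m) by exact: measurable_cube.
have muQ : mu (centered m) = ((m.+1%:R + m.+1%:R) ^+ n)%:E.
  exact: lebesgue_Rn_cube.
have V0 : (0 < (m.+1%:R + m.+1%:R : R) ^+ n)%R by rewrite exprn_gt0.
suff W0 : weak_Lnorm 1 (fun x => (w x `^ q * \1_(centered m) x)%:E) = 0.
  apply/eqP; rewrite eq_le measure_ge0 andbT -(weak_Lnorm_eq0 q0 W0).
  apply: le_lebesgue_Rn => x [xj ?]; split=> //.
  by apply: centered_sub xj; exact: leq_maxr.
pose Z := centered m `&` w @^-1` [set 0%R].
have mZ : measurable Z.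
  by apply: measurableI => //; rewrite -[X in measurable X]setTI; apply: mw.
have muZ : mu Z != 0.
  apply/negP => /eqP muZ; apply: Zk; apply/eqP; rewrite eq_le measure_ge0 andbT.
  rewrite -muZ; apply: (le_lebesgue_Rn_null N0) => x [xk wx].
  have [Nx|Nx] := pselect (N x); [by right|left; split].
    by apply: centered_sub xk; exact: leq_maxl.
  by apply/eqP; rewrite eq_le (wN _ Nx) andbT.
have S_oo : \int[mu]_(x in centered m) ((w x `^ p')%R%:E)^-1 = +oo.
  apply/eqP; rewrite -leye_eq.
  apply: (@le_trans _ _ (\int[mu]_(x in Z) ((w x `^ p')%R%:E)^-1)); last first.
    apply: ge0_subset_integral.
    - exact: mZ.
    - exact: mQ.
    - exact: measurable_funS (measurable_inv_powR _ mw).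
    - by move=> x _; rewrite inve_ge0 lee_fin powR_ge0.
    - exact: subIsetl.
  rewrite (eq_integral (cst +oo)); last first.
    by move=> x /set_mem[_ /= ->]; rewrite powR0 ?gt_eqF// inve0.
  have -> := integral_cst mu mZ +oo.
  by rewrite gt0_mulye// lt_neqAle eq_sym muZ measure_ge0.
(* With infinite dual mass, a nonzero weak norm would make the product for this cube [+oo]. *)
apply: contrapT => /eqP W0; move: wA; rewrite /Apq_star ltNge => /negP; apply.
apply: ereal_sup_ubound; exists (centered m).
  by eexists; eexists; split; [exact: l0|].
rewrite S_oo muQ inver gt_eqF//.
have iV0 : 0 < ((m.+1%:R + m.+1%:R : R) ^- n)%:E by rewrite lte_fin invr_gt0.
rewrite [X in _ * X `^ _]gt0_muley// poweRyr ?gt_eqF ?invr_gt0//.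
rewrite gt0_muley// poweR_gt0// mule_gt0// lt_neqAle eq_sym W0.
exact: weak_Lnorm_ge0.
Qed.

End almost_everywhere.

(** By the dichotomy the weight is either zero almost everywhere, a trivial case, or positive almost
    everywhere, where a change on a null set makes it positive at each point. *)
Lemma weak_type_of_Apq_star (R : realType) (n : nat) (alpha p q : R)
    (w : Rn R n -> R) :
  (0 < alpha < n%:R)%R -> (1 < p < n%:R / alpha)%R ->
  (p^-1 - q^-1 = alpha / n%:R)%R -> weight w -> Apq_star p q w ->
  exists C : R, forall f : Rn R n -> R, weighted_Lp p w f ->
    weak_Lnorm q (fun x => (w x)%:E * fractional_maximal alpha f x)
      <= C%:E * weighted_Lnorm p w f.
Proof.
move=> alpha_n p_lt pq hw wA; have q0 := q_gt0 alpha_n p_lt pq.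
have p1 : (1 < p)%R by case/andP: p_lt.
have [mw _] := hw.
have mpos : measurable [set x | 0 < w x]%R.
  rewrite (_ : [set x | _] = w @^-1` `]0%R, +oo[%classic); last first.
    by apply/seteqP; split=> x /=; rewrite in_itv/= andbT.
  by rewrite -[X in measurable X]setTI; apply: mw.
have [Z0|P0] := Apq_star_zero_or_positive p1 q0 hw wA; last first.
  have [N N0 wN] := ae_null_setP hw.2.
  (* Where [w = 0], the product with the maximal function is 0 even if the latter is [+oo], so every
     superlevel set is null and [C = 0] works. *)
  exists 0%R => f _; rewrite mul0e; apply: ge_ereal_sup => _ [lambda /= l0 <-].
  rewrite [X in X `^ _](_ : _ = 0).
    by rewrite poweR0r ?mule0// gt_eqF// invr_gt0.
  apply/eqP; rewrite eq_le measure_ge0 andbT -P0.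
  apply: (le_lebesgue_Rn_null N0) => x /= lx.
  have [Nx|Nx] := pselect (N x); [by right|left].
  rewrite lt_neqAle (wN _ Nx) andbT; apply/eqP => wx; move: lx.
  by rewrite -wx mul0e abse0 lte_fin ltNge ltW.
(* The value 1 on the null set where [w <= 0] is an arbitrary positive choice. *)
pose v x := if (0 < w x)%R then w x else 1%R.
have mv : measurable_fun setT v.
  apply: measurable_fun_ifT; [|exact: mw|exact: measurable_cst].
  by apply: measurable_fun_ltr; [exact: measurable_cst|exact: mw].
pose N := [set x | w x <= 0]%R.
have vw x : ~ N x -> v x = w x.
  by rewrite /v /N /= => /negP; rewrite -ltNge => ->.
have mN : measurable N.
  rewrite (_ : N = ~` [set x | 0 < w x]%R); first exact: measurableC.
  apply/seteqP; split=> x /=; rewrite /N /=.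
    by move=> h /(le_lt_trans h); rewrite ltxx.
  by move/negP; rewrite -leNgt.
have v0 x : (0 < v x)%R by rewrite /v; case: ifPn.
have [K vK] : exists K : R, Apq_star_const p q v <= K%:E.
  move: wA; rewrite /Apq_star -(Apq_star_const_ae p q mN Z0 mv mw vw).
  by case: Apq_star_const => [K _|//|_]; [exists K|exists 0%R; rewrite leNye].
have [C _ HC] := positive_weak_type alpha_n p_lt pq mv v0 vK.
exists C => f [mf fw].
have normE : weighted_Lnorm p v f = weighted_Lnorm p w f.
  rewrite /weighted_Lnorm.
  suff -> : \int[@lebesgue_Rn R n]_x ((`|f x| `^ p * v x `^ p)%R)%:E =
      \int[@lebesgue_Rn R n]_x ((`|f x| `^ p * w x `^ p)%R)%:E by [].
  apply: ae_eq_integral.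
  - exact: measurableT.
  - exact/measurable_EFin_restrict/measurable_fun_norm_powRM.
  - exact/measurable_EFin_restrict/measurable_fun_norm_powRM.
  by apply: (eq_off_ae mN Z0) => x /vw ->.
have fv : weighted_Lp p v f by split; [exact: mf|rewrite normE].
have := HC f fv; rewrite normE; apply: le_trans.
by apply: (weak_Lnorm_ae_le q0 Z0) => x /vw ->.
Qed.

Theorem theorem1p3 (R : realType) (n : nat) (alpha p q : R) (w : Rn R n -> R)
  (halpha : (0 < alpha < n%:R)%R) (hp : (1 < p < n%:R / alpha)%R)
  (hq : (p^-1 - q^-1 = alpha / n%:R)%R) (hw : weight w) :
  (exists C : R, forall f : Rn R n -> R, weighted_Lp p w f ->
     weak_Lnorm q (fun x => (w x)%:E * fractional_maximal alpha f x)
       <= C%:E * weighted_Lnorm p w f) <->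
  Apq_star p q w.
Proof.
split=> [[C HC]|]; first exact: Apq_star_of_weak_type halpha hp hq hw HC.
exact: weak_type_of_Apq_star.
Qed.
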